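(* Let $\Gamma$ be a countable group with generating set $S\subseteq\Gamma$, let $w$ be a word in $S$ and $m\ge1$ an integer such that $w^m$ is an embedded relation of $\Gamma$, and let $s\in S$ be a generator that appears in $w^m$. Let $$Q=\{g\in\Gamma:(g,sg)\in w^m\text{ or }(sg,g)\in w^m\}.$$ Suppose that $\{1,\overline w,\dots,\overline w^{\,m-1}\}\subseteq Q$ and let $P=Q\setminus\{1,\overline w,\dots,\overline w^{\,m-1}\}$. Assume that there exists a $P$-positive system on $\Gamma$. Then there exists a free probability-measure-preserving (pmp) action $\Gamma\curvearrowright(X,\mu)$ on a standard probability space such that for all $\varepsilon>0$ there is a Borel set $A_\varepsilon\subseteq X$ with $\mu(A_\varepsilon)\ge\frac1m-\varepsilon$ such that $$\mathcal G_\varepsilon:=\mathrm{Sch}(\Gamma\curvearrowright X,S)\setminus\{(s.x,x)^{\pm1}:x\in A_\varepsilon\}$$ is a graphing of $\Gamma\curvearrowright(X,\mu)$.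
   Context: Words and paths. A word in $S$ is a finite sequence $w=s_n\cdots s_1$ with $s_i\in S^{\pm1}$; $\overline w\in\Gamma$ is the element it represents; $w^m$ is the $m$-fold concatenation. A generator $s$ appears in a word if $s$ or $s^{-1}$ is one of its letters. A word $w=s_n\cdots s_1$ is identified with the path $(1,s_1,s_2s_1,\dots,s_n\cdots s_1)$ in the left Cayley graph of $\Gamma$ (edges join $g$ and $sg$, $s\in S$). A word is a relation if it represents $1$; it is an embedded relation if its path starts and ends at the same group element and is injective apart from the coincidence of the two endpoints. For a path $p=(x_1,\dots,x_n)$, write $(y,z)\in p$ if there is $1\le i\le n-1$ with $x_i=y$, $x_{i+1}=z$. For a pair, $(y,z)^{-1}:=(z,y)$ (and $(y,z)^{1}:=(y,z)$). Positive systems. For a finite subset $P\subseteq\Gamma$, a $P$-positive system on $\Gamma$ is a finite sequence $\{P_i,\phi_i\}_{1\le i\le L}$, $L\ge1$, such that: (1) $P_1=P$ and $P_{i+1}=P\cap\ker\phi_i$ for $1\le i<L$; (2) $P\cap\ker\phi_L=\emptyset$; (3) $\phi_i:\langle P_i\rangle\to\mathbf Z$ is a surjective group homomorphism with $\phi_i(g)\ge0$ for each $g\in P_i$ and each $1\le i\le L$. (Each $\ker\phi_i$ is a subgroup of $\langle P_i\rangle\le\Gamma$.) Graphings. A Borel graph on $X$ is a symmetric irreflexive Borel subset of $X^2$. A graphing of a pmp action $\Gamma\curvearrowright(X,\mu)$ is a Borel graph on $X$ whose connected components are precisely the $\Gamma$-orbits on a conull set. The Schreier graph is $\mathrm{Sch}(\Gamma\curvearrowright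 X,S)=\{(t.x,x)^{\pm1}\in X^2:x\in X,\ t\in S\}$, with diagonal pairs $(x,x)$ discarded. *)

(* Defs.v *)
From HB Require Import structures.
From Stdlib Require Import Relation_Operators.
From mathcomp Require Import all_boot all_order all_algebra.
From mathcomp Require Import all_classical all_reals all_analysis.

Set Implicit Arguments.
Unset Strict Implicit.
Unset Printing Implicit Defensive.

Import Order.TTheory GRing.Theory Num.Theory.

Local Open Scope classical_set_scope.
Local Open Scope ring_scope.

Section Groups.
Variable G : groupType.
Implicit Types (S P : set G) (w : seq G).

Definition is_subgroup (H : set G) : Prop :=
  [/\ H 1%g, forall x y, H x -> H y -> H (x * y)%g & forall x, H x -> H (x^-1)%g].

Definition generated S : set G := smallest is_subgroup S.

(* The word s_n ... s_1 is the sequence [:: s_n; ...; s_1], in the order in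
   which it is written; its letters are elements of G. *)
Definition is_word S w : Prop := forall a, a \in w -> S a \/ S (a^-1)%g.

Definition word_val w : G := (\prod_(a <- w) a)%g.

Definition word_pow w (m : nat) : seq G := flatten (nseq m w).

Definition appears (s : G) w : Prop := (s \in w) || ((s^-1)%g \in w).

(* The path (1, s_1, s_2 s_1, ..., s_n ... s_1): letters are read from the right
   and multiplied on the left. *)
Definition word_path w : seq G :=
  (1 :: scanl (fun g a => a * g) 1 (rev w))%g.

Definition embedded_relation w : Prop :=
  last 1%g (word_path w) = 1%g /\
  forall i j : nat, (i < j < size (word_path w))%N ->
    nth 1%g (word_path w) i = nth 1%g (word_path w) j ->
    i = 0%N /\ j = (size (word_path w)).-1.

Definition path_steps (p : seq G) : seq (G * G) := zip p (behead p).

Definition step_set w (s : G) : set G :=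
  [set g | ((g, s * g)%g \in path_steps (word_path w)) \/
           ((s * g, g)%g \in path_steps (word_path w))].

(* phi i is a function on all of G, of which only the values on
   generated (Pi i) are constrained. *)
Record positive_system P (L : nat) (Pi : nat -> set G) (phi : nat -> G -> int)
    : Prop := PositiveSystem {
  ps_finite : finite_set P ;
  ps_length : (1 <= L)%N ;
  ps_first : Pi 1%N = P ;
  ps_next : forall i, (1 <= i < L)%N ->
    Pi i.+1 = P `&` [set g | generated (Pi i) g /\ phi i g = 0] ;
  ps_last : P `&` [set g | generated (Pi L) g /\ phi L g = 0] = set0 ;
  ps_morph : forall i, (1 <= i <= L)%N ->
    forall x y, generated (Pi i) x -> generated (Pi i) y ->
      phi i (x * y)%g = phi i x + phi i y ;
  ps_surj : forall i, (1 <= i <= L)%N ->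
    forall k : int, exists2 g, generated (Pi i) g & phi i g = k ;
  ps_ge0 : forall i, (1 <= i <= L)%N -> forall g, Pi i g -> 0 <= phi i g
}.

Definition has_positive_system P : Prop :=
  exists (L : nat) (Pi : nat -> set G) (phi : nat -> G -> int),
    positive_system P L Pi phi.

End Groups.

Section Actions.
Context {R : realType} {d : measure_display} {X : measurableType d}.

(* X is isomorphic, as a measurable space, to a Borel subset of a Polish space:
   for A = setT the equivalence says that the range of f is Borel. *)
Definition standard_borel : Prop :=
  exists (Y : metricType R) (f : X -> Y),
    [/\ forall F : set_system Y, ProperFilter F -> cauchy F -> exists y : Y, F --> y,
        exists2 D : set Y, countable D & dense D,
        injective f
      & forall A : set X, measurable A <-> <<s [set U : set Y | open U] >> (f @` A)].

Variables (mu : probability X R) (G : groupType) (act : G -> X -> X).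

Record pmp_action : Prop := PmpAction {
  act_one : forall x, act 1%g x = x ;
  act_mul : forall g h x, act (g * h)%g x = act g (act h x) ;
  act_measurable : forall g, measurable_fun setT (act g) ;
  act_preserves : forall g (A : set X), measurable A -> mu (act g @^-1` A) = mu A
}.

Definition free_action : Prop := forall g x, act g x = x -> g = 1%g.

Definition act_orbit (x : X) : set X := [set act g x | g in setT].

Definition schreier (S : set G) : set (X * X) :=
  [set p | p.1 <> p.2 /\
     exists x t, S t /\ (p = (act t x, x) \/ p = (x, act t x))].

Definition edges_over (s : G) (A : set X) : set (X * X) :=
  [set p | exists2 x, A x & p = (act s x, x) \/ p = (x, act s x)].

Definition borel_graph (E : set (X * X)) : Prop :=
  [/\ measurable E, forall x y, E (x, y) -> E (y, x) & forall x, ~ E (x, x)].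

Definition graph_component (E : set (X * X)) (x : X) : set X :=
  [set y | clos_refl_trans X (fun u v => E (u, v)) x y].

Definition graphing (E : set (X * X)) : Prop :=
  borel_graph E /\ {ae mu, forall x, graph_component E x = act_orbit x}.

End Actions.

Arguments standard_borel R {d} X.

(* Main.v *)
Require Import Defs.
From HB Require Import structures.
From Stdlib Require Import Relation_Operators.
From mathcomp Require Import all_boot all_order all_algebra.
From mathcomp Require Import all_classical all_reals all_analysis.
From mathcomp Require Import measurable_realfun.
From mathcomp Require Import zify ring.

(** The word [w ^ m] traces through every point [x] of a free action a simple
    cycle [C(x)].  The pairs [(y, s y)] lying on [C(x)] are those with [y = g x],
    [g \in Q], and [x], [w x], ..., [w^(m-1) x] have the same cycle.  If [A] meets
    every orbit of [w] at most once and the edges [(x, s x)], [x \in A], are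
    removed, then the endpoints of a removed edge [(x, s x)] remain connected by the
    rest of [C(x)] as soon as the same holds for the other removed edges of [C(x)];
    by the choice of [A] these are at points [g x \in A] with [g \in P].  So it is
    enough that the relation [y = g x], [g \in P], [x, y \in A], has no infinite
    descending chain at almost every point ([component_orbit]).

    The positive system makes this possible at the cost of a small part of [A].
    For the map [phi_i] on [H_i = <P_i>], with kernel [K_i] and [phi_i h_i = 1],
    let the points of the space carry random marks on the cosets [K_i g], moved by
    right translation.  Read along the powers of [h_i], the marks of [x] form a
    sequence of bits indexed by the integers, and [g \in H_i] translates it by
    [phi_i g].  Discard from [A] the points with a mark at one of the positions
    [0], ..., [N - 1], where [N] bounds [phi_i] on [P_i].  A step by [g \in P_i]
    moves to the right by at most [N], hence never passes a mark; as almost every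
    sequence has a mark at some nonnegative position, only finitely many steps have
    [phi_i g <> 0], and the others are by elements of [P_(i+1)].  Induction on the
    level [i] gives well-foundedness ([descent_layer], [positive_system_descent]).
    Marks of density [2 ^ - k] cost at most [L * N * 2 ^ - k] of the measure of [A].

    The action is a generalised Bernoulli shift: each coset [K_i g] carries an
    independent sequence of fair bits, and it is marked at level [k] when its first
    [k] bits are true, so that one action serves all [k].  The trivial subgroup is
    added to the family as [K_0] and makes the action free ([labelled_action],
    [exists_labelled_action]).  The bits are binary digits of a uniform real number
    ([uniform_fair_coins]); bit sequences are packed into reals to obtain a standard
    Borel space ([standard_borel_bitspace]).  Finally, a transversal of measure at
    least [1 / m] for the cyclic group generated by [w] consists of the points that
    have the smallest packed value in their orbit ([cyclic_min_measure]). *)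

Set Implicit Arguments.
Unset Strict Implicit.
Unset Printing Implicit Defensive.

Import Order.TTheory GRing.Theory Num.Theory.
Import numFieldNormedType.Exports.

Local Open Scope classical_set_scope.
Local Open Scope ring_scope.

(** * Binary digits and packing of bit sequences *)

Section Bits.
Context {R : realType}.

Definition bit (n : nat) (r : R) : bool := odd (Num.truncn (2 ^+ n.+1 * r)).

Definition pack_term (c : nat -> bool) : R ^nat := fun n => (c n)%:R * 4^-1 ^+ n.+1.

(** The base is 4, not 2, so that the sequence can be recovered: all base-4 digits of
    [pack c] are 0 or 1, and such an expansion is unique. *)
Definition pack (c : nat -> bool) : R := limn (series (pack_term c)).

Lemma pack_cvg c : series (pack_term c) @ \oo --> pack c.
Proof.
have cg : cvgn (series (geometric 4^-1 4^-1 : R^nat)).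
  by apply: is_cvg_geometric_series; rewrite ger0_norm ?invr_ge0// invf_lt1// ltr1n.
apply: (@series_le_cvg _ (pack_term c) (geometric 4^-1 4^-1)) cg => n;
  rewrite /pack_term /=.
- by rewrite mulr_ge0// exprn_ge0.
- by rewrite mulr_ge0// exprn_ge0.
- by rewrite exprS; case: (c n); rewrite ?mul1r// mul0r mulr_ge0// exprn_ge0.
Qed.

Lemma pack_ge0 c : 0 <= pack c.
Proof.
apply: limr_ge; first by apply/cvg_ex; exists (pack c); exact: pack_cvg.
apply: nearW => n; apply: sumr_ge0 => i _.
by rewrite /pack_term mulr_ge0// exprn_ge0.
Qed.

Lemma pack_rec c : pack c = 4^-1 * ((c 0%N)%:R + pack (fun n => c n.+1)).
Proof.
rewrite [LHS]/pack; apply: cvg_lim => //; rewrite -cvg_shiftS /=.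
rewrite (_ : (fun n : nat => _) =
    (fun n => 4^-1 * ((c 0%N)%:R + series (pack_term (fun n => c n.+1)) n)));
  last first.
  apply/funext => n /=; rewrite /series /= big_nat_recl// /pack_term expr1.
  rewrite mulrDr; congr (_ + _); first exact: mulrC.
  rewrite mulr_sumr.
  by apply: eq_bigr => i _; rewrite [RHS]mulrCA -exprS.
by apply: cvgMr; apply: cvgD; [exact: cvg_cst|exact: pack_cvg].
Qed.

Lemma pack_lt1 c : pack c < 1.
Proof.
suff : pack c <= 3^-1 by move=> /le_lt_trans; apply; rewrite invf_lt1// ltr1n.
apply: limr_le; first by apply/cvg_ex; exists (pack c); exact: pack_cvg.
apply: nearW => n; suff : series (pack_term c) n <= 3^-1 * (1 - 4^-1 ^+ n).
  by move/le_trans; apply; rewrite ger_pMr// gerBl exprn_ge0.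
elim: n => [|n IH]; first by rewrite expr0 subrr mulr0 /series /= big_geq.
have cn : pack_term c n <= 4^-1 ^+ n.+1.
  by rewrite /pack_term; case: (c n); rewrite ?mul1r// mul0r exprn_ge0.
rewrite /series /= big_nat_recr//= (le_trans (lerD IH cn))//.
by rewrite exprS le_eqVlt; apply/orP; left; apply/eqP; field.
Qed.

Lemma pack_digits c n : exists a : nat,
  4 ^+ n.+1 * pack c = (4 * a + c n)%:R + pack (fun k => c (n.+1 + k)%N).
Proof.
elim: n c => [|n IH] c.
  by exists 0%N; rewrite pack_rec expr1 mulrA divff// mul1r.
have [a Ha] := IH (fun k => c k.+1).
(* 4 ^ (n + 2) * pack c is 4 ^ (n + 1) * (c 0 + pack of the tail), and its first
   summand is 4 times 4 ^ n * c 0. *)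
exists (4 ^ n * c 0 + a)%N.
rewrite pack_rec exprSr -mulrA (mulrA 4) divff// mul1r mulrDr Ha addrA.
congr (_ + _); rewrite -natrX -natrM -natrD; congr (_%:R).
by rewrite expnS; lia.
Qed.

(** The base-4 digits of [pack c] are at most 1, hence they are its binary digits
    of odd index. *)
Lemma bit_pack c n : bit n.*2.+1 (pack c) = c n.
Proof.
rewrite /bit -doubleS -muln2 mulnC exprM -natrX.
have [a ->] := pack_digits c n.
rewrite (@truncn_def _ _ (4 * a + c n)).
  by rewrite oddD oddM/=; case: (c n).
by rewrite lerDl pack_ge0/= -natr1 ltrD2l pack_lt1.
Qed.

Lemma measurable_bit n : measurable_fun setT (bit n).
Proof.
apply: (measurable_fun_bool true) => //; rewrite setTI.
have -> : bit n @^-1` [set true] =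
    \bigcup_(k in [set k | odd k]) ([set r : R | k%:R <= 2 ^+ n.+1 * r] `&`
                                    [set r : R | 2 ^+ n.+1 * r < k.+1%:R]).
  apply/seteqP; split=> [r|r [k ok [/= k1 k2]]].
    rewrite /bit /=; case: (lerP 0 (2 ^+ n.+1 * r)) => r0 o.
      by have /andP[] := truncn_itv r0; exists (Num.truncn (2 ^+ n.+1 * r)).
    by move: o; rewrite truncn_floor leNgt r0.
  by rewrite /bit /= (@truncn_def _ _ k)// k1.
apply: bigcup_measurable => k _; apply: measurableI.
  have := @measurable_fun_ler _ R R setT (cst k%:R) (fun r : R => 2 ^+ n.+1 * r).
  move=> /(_ _ _ measurableT [set true]); rewrite setTI => H.
  by apply: H => //; exact: measurable_funM.
have := @measurable_fun_ltr _ R R setT (fun r : R => 2 ^+ n.+1 * r) (cst k.+1%:R).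
move=> /(_ _ _ measurableT [set true]); rewrite setTI => H.
by apply: H => //; exact: measurable_funM.
Qed.

Lemma measurable_pack d (T : measurableType d) (c : T -> nat -> bool) :
  (forall n, measurable_fun setT (c ^~ n)) ->
  measurable_fun setT (fun t => pack (c t)).
Proof.
move=> mc; apply: (@measurable_fun_cvg _ _ _ _ (fun n t => series (pack_term (c t)) n)).
  move=> n; apply: measurable_sum => i; apply: measurable_funM => //.
  have -> : (fun t => (c t i)%:R) = (fun b : bool => b%:R : R) \o (c ^~ i) by [].
  by apply: measurableT_comp.
by move=> t _; exact: pack_cvg.
Qed.

Lemma binary_sum_rec n (t : nat -> bool) :
  (\sum_(k < n.+1) t k * 2 ^ (n - k) =
    (\sum_(k < n) t k * 2 ^ (n.-1 - k)) * 2 + t n)%N.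
Proof.
rewrite big_ord_recr/= subnn expn0 muln1 big_distrl/=; congr (_ + _)%N.
apply: eq_bigr => k _; rewrite -mulnA -expnSr; congr (_ * 2 ^ _)%N.
by have := ltn_ord k; lia.
Qed.

(** Through the recursion floor (2 ^ (n + 1) r) = 2 floor (2 ^ n r) + bit n r, the
    first [n] digits determine, and are determined by, the dyadic interval of length
    [2 ^ - n] that contains [r]. *)
Lemma bit_prefix n (r : R) (t : nat -> bool) : 0 <= r < 1 ->
  (forall k, (k < n)%N -> bit k r = t k) <->
  Num.truncn (2 ^+ n * r) = (\sum_(k < n) t k * 2 ^ (n.-1 - k))%N.
Proof.
move=> /andP[r0 r1]; elim: n => [|n IH].
  rewrite big_ord0 expr0 mul1r; split=> // _.
  by apply: truncn_def; rewrite r0 r1.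
have E : Num.truncn (2 ^+ n.+1 * r) = (Num.truncn (2 ^+ n * r) * 2 + bit n r)%N.
  have x0 : 0 <= 2 ^+ n * r by rewrite mulr_ge0// exprn_ge0.
  have y0 : 0 <= 2 ^+ n.+1 * r by rewrite mulr_ge0// exprn_ge0.
  have /andP[a1 a2] := truncn_itv x0.
  have /andP[b1 b2] := truncn_itv y0.
  rewrite /bit; set A := Num.truncn _ in a1 a2 *; set B := Num.truncn _ in b1 b2 *.
  have B1 : (A * 2 < B.+1)%N.
    rewrite -(ltr_nat R) (le_lt_trans _ b2)// exprS natrM mulrC -mulrA.
    by rewrite ler_pM2l.
  have B2 : (B < A.+1 * 2)%N.
    rewrite -(ltr_nat R) (le_lt_trans b1)// exprS natrM [ltRHS]mulrC -mulrA.
    by rewrite ltr_pM2l.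
  by lia.
rewrite E binary_sum_rec; split=> [H|H].
  by rewrite (H n)// (IH.1 _)// => k kn; apply: H; exact: ltnW.
have [H1 H2] : Num.truncn (2 ^+ n * r) = (\sum_(k < n) t k * 2 ^ (n.-1 - k))%N /\
    bit n r = t n.
  by move: H; case: (bit n r); case: (t n); lia.
move=> k; rewrite ltnS leq_eqVlt => /orP[/eqP->//|]; exact: (IH.2 H1).
Qed.

Lemma measurable_bit_prefix n (t : nat -> bool) :
  measurable [set r : R | forall k, (k < n)%N -> bit k r = t k].
Proof.
rewrite (_ : mkset _ = \bigcap_(k in `I_n) (bit k @^-1` [set t k])).
  apply: fin_bigcap_measurable => [|k _]; first exact: finite_II.
  by rewrite -[X in measurable X]setTI; exact: measurable_bit.
by apply/seteqP; split.
Qed.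

Lemma uniform_prob01E (U : set R) : measurable U ->
  uniform_prob (@ltr01 R) U = lebesgue_measure (U `&` `[0, 1]).
Proof.
move=> mU; rewrite /uniform_prob integral_uniform_pdf.
rewrite (eq_integral (cst 1%E)); last first.
  move=> x; rewrite inE => -[_ /=]; rewrite in_itv/= /uniform_pdf => ->.
  by rewrite subr0 invr1.
rewrite integral_cst ?mul1e//.
by apply: measurableI.
Qed.

(** Inside [[0, 1]] this event is a dyadic interval of length [2 ^ - n], up to the
    endpoint 1, which has measure 0. *)
Lemma uniform_bit_prefix n (t : nat -> bool) :
  uniform_prob (@ltr01 R) [set r | forall k, (k < n)%N -> bit k r = t k] =
  (2^-1 ^+ n)%:E.
Proof.
rewrite uniform_prob01E; last exact: measurable_bit_prefix.
set U := [set r | _].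
set a := (\sum_(k < n) t k * 2 ^ (n.-1 - k))%N.
have a_lt : (a < 2 ^ n)%N.
  rewrite /a; elim: {a U} n => [|n IH]; first by rewrite big_ord0.
  by rewrite binary_sum_rec expnS; case: (t n) IH => /=; lia.
have p0 : (0 : R) < 2 ^+ n by rewrite exprn_gt0.
pose I : set R := `[a%:R / 2 ^+ n, a.+1%:R / 2 ^+ n[%classic.
have mU : measurable (U `&` `[0, 1]).
  by apply: measurableI => //; exact: measurable_bit_prefix.
have IP r : I r <-> a%:R <= 2 ^+ n * r < a.+1%:R.
  by rewrite /I /= in_itv/= ler_pdivrMr// ltr_pdivlMr// [r * _]mulrC.
have I01 r : I r -> 0 <= r < 1.
  move=> /(IP r) /andP[r1 r2]; apply/andP; split.
    by rewrite -(pmulr_rge0 _ p0) (le_trans _ r1).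
  by rewrite -(ltr_pM2l p0) mulr1 (lt_le_trans r2)// -natrX ler_nat.
have IU : I `<=` U `&` `[0, 1].
  move=> u Iu; have u01 := I01 _ Iu; have /andP[u0 u1] := u01.
  split; last by rewrite /= in_itv/= u0 ltW.
  by apply/(bit_prefix n t u01); apply: truncn_def; exact/IP.
have UI : U `&` `[0, 1] `<=` I `|` [set 1].
  move=> r [Ur]; rewrite /= in_itv/= => /andP[r0].
  rewrite le_eqVlt => /orP[/eqP ->|r1]; first by right.
  left; apply/IP; rewrite -(_ : Num.truncn (2 ^+ n * r) = a).
    by apply: truncn_itv; rewrite mulr_ge0// ltW.
  by apply/(bit_prefix n t) => //; rewrite r0 r1.
have mI : measurable I by exact: measurable_itv.
have lI : (lebesgue_measure I = (2^-1 ^+ n)%:E :> \bar R)%E.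
  rewrite lebesgue_measure_itv/= lte_fin ltr_pM2r ?invr_gt0// ltr_nat ltnSn.
  by rewrite -EFinD -mulrBl -natrB// subSnn mul1r exprVn.
apply/eqP; rewrite eq_le -lI; apply/andP; split.
  rewrite (@le_trans _ _ (lebesgue_measure (I `|` [set 1])))//.
    by apply: le_measure => //; rewrite inE//; exact: measurableU.
  rewrite (le_trans (measureU2 _ _ _))//.
  by rewrite [X in (_ + X)%E](_ : _ = 0%E) ?adde0//; exact: lebesgue_measure_set1.
by apply: le_measure => //; rewrite inE.
Qed.

End Bits.

(** * Families of fair coins *)

Lemma uniq_map_inj_in (A B : eqType) (f : A -> B) (l : seq A) :
  uniq (map f l) -> {in l &, injective f}.
Proof.
elim: l => //= a l IH /andP[fa ul] x y; rewrite !inE.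
move=> /orP[/eqP->|xl] /orP[/eqP->|yl] E //; last exact: IH.
  by move: fa; rewrite E map_f.
by move: fa; rewrite -E map_f.
Qed.

Lemma uniq_flatten_iota (K : nat -> seq nat) n :
  (forall n, uniq (K n)) -> (forall m n x, x \in K m -> x \in K n -> m = n) ->
  uniq (flatten (map K (iota 0 n))).
Proof.
move=> uK dK; elim: n => // n IH.
rewrite -addn1 iotaD map_cat flatten_cat/= cats0 cat_uniq IH uK andbT /=.
apply/hasPn => x xn; apply/negP => /flattenP[_ /mapP[m + ->]] xm.
by rewrite mem_iota (dK _ _ _ xm xn) add0n ltnn.
Qed.

Definition cylinder (l : seq (nat * bool)) : set (nat -> bool) :=
  [set c | forall p, p \in l -> c p.1 = p.2].

Lemma cylinder_nil : cylinder [::] = setT.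
Proof. by apply/seteqP; split. Qed.

Lemma cylinder_cons p l : cylinder (p :: l) = [set c | c p.1 = p.2] `&` cylinder l.
Proof.
apply/seteqP; split=> [c H|c [cp H] q].
  by split=> [|q ql]; apply: H; rewrite inE ?eqxx// ql orbT.
by rewrite inE => /orP[/eqP->|]//; exact: H.
Qed.

Lemma cylinder_cat l1 l2 : cylinder (l1 ++ l2) = cylinder l1 `&` cylinder l2.
Proof.
by elim: l1 => [|p l1 IH]; rewrite ?cylinder_nil ?setTI//= !cylinder_cons IH setIA.
Qed.

Section FairCoins.
Context {R : realType} {d} {T : measurableType d} (P : probability T R).
Implicit Types (xi : T -> nat -> bool) (l : seq (nat * bool)).

(** Independence is expressed by the probabilities of the cylinders that prescribe
    the values of finitely many distinct coordinates. *)
Definition fair_coins xi : Prop :=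
  (forall n, measurable_fun setT (xi ^~ n)) /\
  (forall l, uniq (map fst l) -> P (xi @^-1` cylinder l) = (2^-1 ^+ size l)%:E).

Lemma measurable_cylinder xi l : (forall n, measurable_fun setT (xi ^~ n)) ->
  measurable (xi @^-1` cylinder l).
Proof.
move=> mxi; elim: l => [|p l IH]; first by rewrite cylinder_nil preimage_setT.
rewrite cylinder_cons preimage_setI; apply: measurableI => //.
by rewrite -[X in measurable X]setTI; exact: (mxi p.1 measurableT [set p.2]).
Qed.

Lemma fair_coins_reindex xi (f : nat -> nat) : fair_coins xi -> injective f ->
  fair_coins (fun t n => xi t (f n)).
Proof.
move=> [mxi fxi] fI; split=> [n|l ul]; first exact: mxi.
have -> : (fun t n => xi t (f n)) @^-1` cylinder l =
    xi @^-1` cylinder [seq (f p.1, p.2) | p <- l].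
  apply/seteqP; split=> [t H _ /mapP[p pl ->]|t H p pl]; first exact: H.
  by apply: (H (f p.1, p.2)); apply/mapP; exists p.
rewrite fxi ?size_map//.
have -> : map fst [seq (f p.1, p.2) | p <- l] = map f (map fst l).
  by rewrite -!map_comp.
by rewrite map_inj_uniq.
Qed.

(** The patterns sit on disjoint blocks of [k] coordinates, so that the first [n] of
    them all fail with probability (1 - 2 ^ - k) ^ n.  The induction on [n] subtracts
    from the failure of the first [n] patterns the case where pattern [n] occurs;
    for this it has to be carried out inside an arbitrary cylinder [l]. *)
Lemma fair_coins_pattern_occurs xi (M : nat -> seq (nat * bool)) (k : nat) :
  fair_coins xi ->
  (forall n, size (M n) = k) -> (forall n, uniq (map fst (M n))) ->
  (forall m n j, j \in map fst (M m) -> j \in map fst (M n) -> m = n) ->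
  {ae P, forall t, exists n, cylinder (M n) (xi t)}.
Proof.
move=> [mxi fxi] sM u1M disM.
have uM n : uniq (map fst (flatten (map M (iota 0 n)))).
  by rewrite map_flatten -map_comp; exact: uniq_flatten_iota.
set Z := [set t | forall n, ~ cylinder (M n) (xi t)].
pose q : R := 1 - 2^-1 ^+ k.
pose S n l := xi @^-1` cylinder l `&`
  [set t | forall j, (j < n)%N -> ~ cylinder (M j) (xi t)].
have SS n l : S n.+1 l = S n l `\` S n (l ++ M n).
  apply/seteqP; split=> t; rewrite /S cylinder_cat.
    move=> [tl H]; split; first by split=> // j jn; apply: H; exact: ltnW.
    by move=> [[_ tM] _]; exact: (H n).
  move=> [[tl H] N]; split=> // j; rewrite ltnS leq_eqVlt => /orP[/eqP->|].
    by move=> tM; apply: N.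
  exact: H.
have mS n l : measurable (S n l).
  elim: n l => [|n IH] l.
    rewrite (_ : S 0%N l = xi @^-1` cylinder l); first exact: measurable_cylinder.
    by apply/seteqP; split=> [t []|t]//; split.
  by rewrite SS; exact: measurableD.
have PS n l : uniq (map fst (l ++ flatten (map M (iota 0 n)))) ->
    P (S n l) = (q ^+ n * 2^-1 ^+ size l)%:E.
  elim: n l => [|n IH] l.
    rewrite cats0 expr0 mul1r => ul; rewrite -fxi//; congr (P _).
    by apply/seteqP; split=> [t []|t]//; split.
  have -> : flatten (map M (iota 0 n.+1)) = flatten (map M (iota 0 n)) ++ M n.
    by rewrite -addn1 iotaD map_cat flatten_cat/= cats0.
  move=> ul.
  have sub : S n (l ++ M n) `<=` S n l.
    by move=> t [+ H]; rewrite cylinder_cat => -[].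
  have P1 : P (S n l) = (q ^+ n * 2^-1 ^+ size l)%:E.
    by apply: IH; move: ul; rewrite catA map_cat cat_uniq => /andP[].
  have P2 : P (S n (l ++ M n)) = (q ^+ n * 2^-1 ^+ (size l + k))%:E.
    rewrite -(sM n) -size_cat; apply: IH.
    by rewrite -catA !map_cat uniq_catCA uniq_catC -catA -!map_cat.
  rewrite SS measureD//; last first.
    by rewrite (le_lt_trans (probability_le1 _ _)) ?ltry//.
  rewrite setIidr//; apply: (eq_trans (congr2 (fun x y => x - y)%E P1 P2)).
  by rewrite -EFinB exprD exprSr /q; congr (_%:E); ring.
have mZ : measurable Z.
  rewrite (_ : Z = \bigcap_n ~` (xi @^-1` cylinder (M n))).
    by apply: bigcap_measurable => // n _; apply/measurableC/measurable_cylinder.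
  by apply/seteqP; split=> [t H n _|t H n]; [exact: H|exact: (H n)].
have q0 : 0 <= q by rewrite subr_ge0 exprn_ile1// invf_le1// ler1n.
have q1 : q < 1 by rewrite gtrBl exprn_gt0.
have ZP n : fine (P Z) <= q ^+ n.
  rewrite -lee_fin fineK ?fin_num_measure//.
  have -> : q ^+ n = q ^+ n * 2^-1 ^+ (@size (nat * bool) [::]) by rewrite mulr1.
  rewrite -PS ?uM//; apply: le_measure; rewrite ?inE//.
  by move=> t Zt; split=> [|j _]; rewrite ?cylinder_nil//; exact: Zt.
exists Z; split=> //; last by move=> t /forallNP.
apply/eqP; rewrite -[P Z]fineK ?fin_num_measure// eqe eq_le fine_ge0// andbT.
have c0 : (fun n => q ^+ n) @ \oo --> (0 : R) by apply: cvg_expr; rewrite ger0_norm.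
rewrite -(cvg_lim _ c0)//; apply: limr_ge; first by apply/cvg_ex; exists 0.
exact: nearW.
Qed.

End FairCoins.

(** A contradictory list prescribes the empty event; any other list, once its
    repetitions are removed, prescribes distinct coordinates. *)
Lemma fair_coins_law {R : realType} d d' (T : measurableType d) (T' : measurableType d')
    (P : probability T R) (P' : probability T' R) xi xi' l :
  fair_coins P xi -> fair_coins P' xi' ->
  P (xi @^-1` cylinder l) = P' (xi' @^-1` cylinder l).
Proof.
move=> [_ f] [_ f'].
have -> : cylinder l = cylinder (undup l).
  by apply/seteqP; split=> c H p pl; apply: H; move: pl; rewrite mem_undup.
have [ul|ul] := boolP (uniq (map fst (undup l))); first by rewrite f// f'.
suff -> : cylinder (undup l) = set0 by rewrite !preimage_set0 !measure0.
apply/seteqP; split=> // c H; apply: (negP ul).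
rewrite map_inj_in_uniq ?undup_uniq// => -[k b] [k' b'] kl kl' /= kk.
by have := H _ kl; have /= <- := H _ kl'; rewrite kk /= => <-.
Qed.

(** Prescribing all of the first [N] digits is [uniform_bit_prefix].  If a digit [j]
    below [N] is left free, the event is the disjoint union of the two events that
    prescribe it, which gives a downward induction on the number of prescribed
    digits. *)
Lemma uniform_fair_coins (R : realType) :
  fair_coins (uniform_prob (@ltr01 R)) (fun r n => bit n r).
Proof.
split=> [n|l ul]; first exact: measurable_bit.
have [N lN] : exists N, all (gtn N) (map fst l).
  exists (\max_(i <- map fst l) i).+1; apply/allP => i il /=.
  by rewrite ltnS; exact: leq_bigmax_seq.
move En : (N - size l)%N => n.
elim: n l ul lN En => [|n IH] l ul lN En.
  have sl : (size l <= N)%N.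
    rewrite -(size_map fst) -[leqRHS](size_iota 0); apply: uniq_leq_size => // i il.
    by rewrite mem_iota add0n; exact: (allP lN).
  have {En}sl : size l = N by lia.
  rewrite sl -(uniform_bit_prefix N (fun k => (k, true) \in l)).
  congr (uniform_prob _ _); apply/seteqP; split=> r /= H.
    move=> k kN.
    have : k \in map fst l.
      have [|| _ ->] := uniq_min_size ul (s2 := iota 0 N).
      - by move=> i il; rewrite mem_iota add0n; exact: (allP lN).
      - by rewrite size_map size_iota sl.
      - by rewrite mem_iota.
    move=> /mapP[[k' b] kl /= ->]; rewrite (H _ kl)/=.
    case: b kl => kl; first by rewrite kl.
    by apply/esym/negP => /(uniq_map_inj_in ul kl) /=/(_ erefl).
  move=> [k b] kl /=; rewrite H; last by apply: (allP lN); apply/mapP; exists (k, b).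
  case: b kl => kl; first by rewrite kl.
  by apply/negP => /(uniq_map_inj_in ul kl) /=/(_ erefl).
have [j jN jl] : exists2 j, (j < N)%N & j \notin map fst l.
  apply: contrapT => H.
  have : (size (iota 0 N) <= size (map fst l))%N.
    apply: uniq_leq_size; first exact: iota_uniq.
    move=> i; rewrite mem_iota add0n => /= iN; apply: contrapT => /negP il.
    by apply: H; exists i.
  by rewrite size_iota size_map; lia.
have Hb b : uniform_prob (@ltr01 R)
    ((fun r n => bit n r) @^-1` cylinder ((j, b) :: l)) =
    (2^-1 ^+ (size l).+1)%:E.
  by apply: IH; rewrite /= ?jl ?ul ?jN//; lia.
have -> : ((fun r n => bit n r) @^-1` cylinder l : set R) =
    (fun r n => bit n r) @^-1` cylinder ((j, true) :: l) `|`
    (fun r n => bit n r) @^-1` cylinder ((j, false) :: l).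
  rewrite !cylinder_cons; apply/seteqP; split=> r /=.
    by case E : (bit j r); [left|right].
  by move=> [][].
have mb l' : measurable ((fun r n => bit n r) @^-1` cylinder l' : set R).
  by apply: measurable_cylinder => k; exact: measurable_bit.
rewrite measureU//.
  apply: (eq_trans (congr2 (fun x y => x + y)%E (Hb true) (Hb false))).
  by rewrite -EFinD exprS; congr (_%:E); field.
- exact: mb.
- exact: mb.
rewrite !cylinder_cons; apply/seteqP; split=> // r [[/= + _] [+ _]].
by move=> /= ->.
Qed.

(** * Standard Borel spaces of bit sequences *)

Section BorelOpen.
Context {R : realType}.

Lemma measurable_open_sigma (A : set R) :
  measurable A <-> <<s [set U : set R^o | open U] >> A.
Proof.
split; last first.
  move=> sA; apply: (@smallest_sub _ (sigma_algebra [set: R]) _ (@measurable _ R)) sA.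
    exact: sigma_algebra_measurable.
  by move=> U oU; exact: open_measurable.
move=> mA; have {mA} : <<s @RGenOpens.G R >> A.
  by rewrite -[X in X _]RGenOpens.measurableE.
apply: smallest_sub; first exact: smallest_sigma_algebra.
move=> _ [x [y ->]]; apply: sub_sigma_algebra; exact: itv_open.
Qed.

End BorelOpen.

Section BitSpace.
Context {R : realType}.
Variables (F : set (nat -> bool)) (pt : {c | F c}).

(** The base point is a parameter of the type, from which the structure of pointed
    type is inferred. *)
Definition bitspace of {c | F c} : Type := {c | F c}.

HB.instance Definition _ := gen_eqMixin (bitspace pt).
HB.instance Definition _ := gen_choiceMixin (bitspace pt).
HB.instance Definition _ := isPointed.Build (bitspace pt) pt.

Definition code (x : bitspace pt) : R := pack (proj1_sig x).

Definition digits (r : R) : nat -> bool := fun n => bit n.*2.+1 r.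

Lemma pack_digitsK : cancel pack digits.
Proof. by move=> c; apply/funext => n; exact: bit_pack. Qed.

Lemma code_inj : injective code.
Proof.
move=> [c Fc] [c' Fc'] /(can_inj pack_digitsK)/= cc.
by subst c'; congr exist; exact: Prop_irrelevance.
Qed.

Definition borel_bitspace := g_sigma_algebra_preimageType code.

Lemma measurable_code : measurable_fun setT (code : borel_bitspace -> R).
Proof. by move=> _ B mB; exists B. Qed.

Lemma measurable_digits n : measurable_fun setT (fun r => digits r n).
Proof. exact: measurable_bit. Qed.

Lemma measurable_coord n :
  measurable_fun setT (fun x : borel_bitspace => proj1_sig x n).
Proof.
rewrite (_ : (fun _ => _) = (fun r => digits r n) \o code).
  exact: (measurableT_comp (measurable_digits n) measurable_code).
by apply/funext => x /=; rewrite /code pack_digitsK.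
Qed.

Lemma measurable_to_bitspace d (T : measurableType d) (g : T -> borel_bitspace) :
  (forall n, measurable_fun setT (fun t => proj1_sig (g t) n)) ->
  measurable_fun setT g.
Proof.
move=> mg _ _ [B mB <-]; rewrite !setTI -comp_preimage.
have := @measurable_pack R _ T (fun t => proj1_sig (g t)) mg.
by move=> /(_ measurableT B mB); rewrite setTI.
Qed.

Lemma range_code : range code = [set r | F (digits r) /\ pack (digits r) = r].
Proof.
apply/seteqP; split=> [_ [[c Fc] _ <-]|r [Fr Er]].
  by rewrite /code /= pack_digitsK.
by exists (exist _ _ Fr).
Qed.

(** The map [code] embeds the space in the real line, and a real number [r] is in
    its range exactly when the digits of [r] form a sequence in [F] from which [pack]
    returns [r]: a Borel condition. *)
Lemma standard_borel_bitspace : measurable [set r | F (digits r)] ->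
  standard_borel R borel_bitspace.
Proof.
move=> mF; have mrange : measurable (range code).
  rewrite range_code; apply: measurableI => //.
  have := @measurable_fun_eqr _ R R setT (fun r => pack (digits r)) id.
  move=> /(_ _ _ measurableT [set true]); rewrite setTI => H.
  rewrite [X in measurable X](_ : _ =
      (fun r => pack (digits r) == r) @^-1` [set true]).
    by apply: H => //; exact: measurable_pack measurable_digits.
  by apply/seteqP; split=> r /= /eqP.
exists R^o, code; split.
- by move=> E PE cE; exists (lim E); exact: cauchy_cvg.
- exists (range (ratr : rat -> R)); last exact: dense_rat.
  exact: (sub_countable (card_image_le _ _)).
- exact: code_inj.
move=> A; rewrite -measurable_open_sigma; split=> [[B mB <-]|mA].
  rewrite setTI (_ : code @` _ = B `&` range code); first exact: measurableI.
  apply/seteqP; split=> [_ [x Bx <-]|r [Bx [x _ Ex]]]; first by split=> //; exists x.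
  by exists x => //=; rewrite Ex.
exists (code @` A) => //; rewrite setTI.
apply/seteqP; split=> [x [y Ay /code_inj <-]//|x Ax]; by exists x.
Qed.

(** The cylinders are stable under intersection, and they generate the sigma-algebra
    pulled back by [code] since [pack] is a limit of functions of finitely many
    coordinates. *)
Lemma bitspace_law_unique (m1 m2 : probability borel_bitspace R) :
  (forall l, m1 (@proj1_sig _ _ @^-1` cylinder l) =
             m2 (@proj1_sig _ _ @^-1` cylinder l)) ->
  forall A, measurable A -> m1 A = m2 A.
Proof.
move=> m12.
pose cylinders := [set A : set borel_bitspace |
  exists l, A = @proj1_sig _ _ @^-1` cylinder l].
have mcylinders : cylinders `<=` measurable.
  by move=> _ [l ->]; apply: measurable_cylinder => n; exact: measurable_coord.
have sub : (@measurable _ borel_bitspace) `<=` <<s cylinders >>.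
  move=> A mA.
  have := @measurable_to_bitspace _ (g_sigma_algebraType cylinders) id _
    measurableT A mA.
  rewrite setTI; apply => n; apply: (measurable_fun_bool true); rewrite setTI.
  apply: sub_sigma_algebra; exists [:: (n, true)].
  by rewrite cylinder_cons cylinder_nil setIT.
move=> A /sub.
apply: (@g_sigma_algebra_measure_unique _ R borel_bitspace cylinders mcylinders
  (fun=> setT)) => //.
- by move=> _; exists [::]; rewrite cylinder_nil.
- by rewrite bigcup_const//; exists 0%N.
- by move=> _ _ [l ->] [l' ->]; exists (l ++ l'); rewrite cylinder_cat.
- by move=> _ [l ->]; exact: m12.
- by move=> _; rewrite (le_lt_trans (probability_le1 _ _)) ?ltry.
Qed.

End BitSpace.

(** * Countable quantifiers and almost everywhere statements *)

Section Countable.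
Context d (T : measurableType d) (R : realType).

Lemma countable_setT_prod (I J : Type) : countable [set: I] ->
  countable [set: J] -> countable [set: (I * J)%type].
Proof. by rewrite -setXTT; exact: countableX. Qed.

Lemma countable_measurableI (I : Type) (F : I -> set T) : countable [set: I] ->
  (forall i, measurable (F i)) -> measurable [set x | forall i, F i x].
Proof.
move=> cI mF; rewrite (_ : mkset _ = ~` \bigcup_i ~` F i).
  by apply/measurableC/countable_bigcupT_measurable => // i; exact: measurableC.
apply/seteqP; split=> [x H [i _]|x H i]; first by apply; exact: H.
by apply: contrapT => nF; apply: H; exists i.
Qed.

Lemma countable_measurableU (I : Type) (F : I -> set T) : countable [set: I] ->
  (forall i, measurable (F i)) -> measurable [set x | exists i, F i x].
Proof.
move=> cI mF; rewrite (_ : mkset _ = \bigcup_i F i).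
  exact: countable_bigcupT_measurable.
by apply/seteqP; split=> [x [i Fi]|x [i _ Fi]]; exists i.
Qed.

Lemma measurable_eq_bool (f g : T -> bool) : measurable_fun setT f ->
  measurable_fun setT g -> measurable [set x | f x = g x].
Proof.
move=> mf mg.
rewrite (_ : mkset _ = (f @^-1` [set true] `&` g @^-1` [set true]) `|`
                       (f @^-1` [set false] `&` g @^-1` [set false])).
  apply: measurableU; apply: measurableI; rewrite -[X in measurable X]setTI;
    first [exact: mf | exact: mg].
apply/seteqP; split=> x /=; last by move=> [] [-> ->].
by move=> ->; case: (g x); [left|right].
Qed.

Lemma measurable_all_lt (f : nat -> T -> bool) k :
  (forall n, measurable_fun setT (f n)) ->
  measurable [set x | forall n, (n < k)%N -> f n x].
Proof.
move=> mf; rewrite (_ : mkset _ = \bigcap_(n in `I_k) (f n @^-1` [set true])).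
  apply: fin_bigcap_measurable => [|n _]; first exact: finite_II.
  by rewrite -[X in measurable X]setTI; exact: mf.
by apply/seteqP; split.
Qed.

Lemma countable_ae (mu : probability T R) (I : Type) (Q : I -> T -> Prop) :
  countable [set: I] -> (forall i, {ae mu, forall x, Q i x}) ->
  {ae mu, forall x, forall i, Q i x}.
Proof.
move=> /countable_injP[f finj] aeQ.
have : {ae mu, forall x, forall n i, f i = n -> Q i x}.
  apply: ae_foralln => n.
  have [[i fi]|nf] := pselect (exists i, f i = n).
    apply: filterS (aeQ i) => x Qi j fj.
    by rewrite (_ : j = i)//; apply: finj; rewrite ?inE// fi.
  by apply: aeW => x i fi; exfalso; apply: nf; exists i.
by apply: filterS => x H i; exact: (H (f i)).
Qed.

Lemma ae_of_null (mu : probability T R) (Q : T -> Prop) :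
  measurable [set x | Q x] -> mu [set x | ~ Q x] = 0 -> {ae mu, forall x, Q x}.
Proof. by move=> mQ Q0; exists [set x | ~ Q x]; split=> //; exact: measurableC. Qed.

Lemma probability_ae_eq (mu : probability T R) (A B : set T) (Q : T -> Prop) :
  measurable A -> measurable B -> {ae mu, forall x, Q x} ->
  (forall x, Q x -> A x <-> B x) -> mu A = mu B.
Proof.
move=> mA mB [N [mN N0 QN]] AB.
have le (C D : set T) : measurable C -> measurable D ->
    (forall x, Q x -> C x -> D x) -> (mu C <= mu D)%E.
  move=> mC mD CD.
  apply: (@le_trans _ _ (mu (D `|` N))).
    apply: le_measure; rewrite ?inE//; first exact: measurableU.
    move=> x Cx; have [Qx|nQx] := pselect (Q x); first by left; exact: CD.
    by right; exact: QN.
  rewrite (le_trans (measureU2 _ _ _))// -[leRHS]adde0 leeD2l//.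
  by rewrite le_eqVlt; apply/orP; left; apply/eqP; exact: N0.
by apply/eqP; rewrite eq_le; apply/andP; split; apply: le => // x Qx; apply AB.
Qed.

Lemma pushforward_probability d' (T' : measurableType d') (P : probability T R)
    (f : T -> T') : measurable_fun setT f ->
  exists mu : probability T' R, forall A, mu A = P (f @^-1` A).
Proof.
move=> mf; pose X : {mfun T >-> T'} := mfun_Sub (mem_set mf).
by exists (distribution P X).
Qed.

End Countable.

(** * Generalised Bernoulli shifts *)

(** [rep i] chooses representatives of the cosets [K_i g] of some subgroup [K_i], and
    [lab x g i n] is bit number [n] carried by the point [x] at the coset [K_i g].
    A coset is marked at level [k] when its first [k] bits are true: [la_mark] gives
    the density of marks, and by [la_recur] an infinite sequence of distinct cosets
    almost surely meets a mark.  The real-valued [code] separates points; it is used to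
    select points in orbits and to describe graphs of the action. *)
Record labelled_action (R : realType) (G : groupType) (rep : nat -> G -> G)
    (d : measure_display) (X : measurableType d) (mu : probability X R)
    (act : G -> X -> X) (code : X -> R) (lab : X -> G -> nat -> nat -> bool)
    : Prop := LabelledAction {
  la_borel : standard_borel R X ;
  la_pmp : pmp_action mu act ;
  la_free : free_action act ;
  la_code_meas : measurable_fun setT code ;
  la_code_inj : injective code ;
  la_lab_meas : forall g i n, measurable_fun setT (fun x => lab x g i n) ;
  la_lab_act : forall g x h i n, lab (act g x) h i n = lab x (h * g)%g i n ;
  la_lab_coset : forall g h i n, rep i g = rep i h ->
    {ae mu, forall x, lab x g i n = lab x h i n} ;
  la_mark : forall g i k,
    mu [set x | forall b, (b < k)%N -> lab x g i b] = (2^-1 ^+ k)%:E ;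
  la_recur : forall i k (g : nat -> G), injective (rep i \o g) ->
    {ae mu, forall x, exists l, forall b, (b < k)%N -> lab x (g l) i b}
}.

Section Shift.
Context {R : realType} {G : groupType}.
Hypothesis countableG : countable [set: G].
Variable rep : nat -> G -> G.
Hypothesis rep0 : forall g, rep 0 g = g.
Hypothesis repK : forall i g, rep i (rep i g) = rep i g.
Hypothesis repM : forall i g h, rep i (rep i g * h)%g = rep i (g * h)%g.
Variables (enc : G * nat * nat -> nat) (dec : nat -> G * nat * nat).
Hypotheses (encK : cancel enc dec) (decK : cancel dec enc).

Definition shift (g : G) (c : nat -> bool) : nat -> bool :=
  fun n => let: (h, i, k) := dec n in c (enc ((h * g)%g, i, k)).

Lemma shift_enc g c h i k : shift g c (enc (h, i, k)) = c (enc ((h * g)%g, i, k)).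
Proof. by rewrite /shift encK. Qed.

Lemma eq_enc (c c' : nat -> bool) :
  (forall h i k, c (enc (h, i, k)) = c' (enc (h, i, k))) -> c = c'.
Proof. by move=> H; apply/funext => n; rewrite -(decK n); case: (dec n) => [[]]. Qed.

Lemma shift1 c : shift 1%g c = c.
Proof. by apply: eq_enc => h i k; rewrite shift_enc mulg1. Qed.

Lemma shiftM g h c : shift (g * h)%g c = shift g (shift h c).
Proof. by apply: eq_enc => u i k; rewrite !shift_enc mulgA. Qed.

(** All points of the space must have trivial stabiliser, not just almost all, so
    the other sequences are removed from it. *)
Definition free_conf : set (nat -> bool) :=
  [set c | forall g, shift g c = c -> g = 1%g].

Lemma free_shift g c : free_conf c -> free_conf (shift g c).
Proof.
move=> fc h H; have : shift (g^-1 * h * g)%g c = c.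
  by rewrite !shiftM H -shiftM mulVg shift1.
move=> /fc /(congr1 (fun x => g * x * g^-1)%g).
by rewrite !mulgA mulgV mul1g mulgK mulg1 mulgV.
Qed.

Lemma measurable_free_conf d (T : measurableType d) (c : T -> nat -> bool) :
  (forall n, measurable_fun setT (c ^~ n)) -> measurable [set t | free_conf (c t)].
Proof.
move=> mc.
rewrite (_ : mkset _ =
    [set t | forall g, g = 1%g \/ exists n, shift g (c t) n != c t n]).
  apply: countable_measurableI => // g; have [->|g1] := eqVneq g 1%g.
    by rewrite [X in measurable X](_ : _ = setT)//; apply/seteqP; split=> // t _; left.
  rewrite [X in measurable X](_ : _ =
    [set t | exists n, shift g (c t) n != c t n]); last first.
    by apply/seteqP; split=> t /=; [case=> // E; rewrite E eqxx in g1|right].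
  apply: countable_measurableU => // n.
  rewrite [X in measurable X](_ : _ = ~` [set t | shift g (c t) n = c t n]).
    apply/measurableC/measurable_eq_bool => //.
    by rewrite /shift; case: (dec n) => [[h i] k].
  by apply/seteqP; split=> t /= /eqP.
apply/seteqP; split=> t.
  move=> fc g; have [->|/eqP g1] := eqVneq g 1%g; [by left|right].
  apply: contrapT => H; apply: g1; apply: fc; apply/funext => n.
  by apply/eqP; apply: contrapT => /negP E; apply: H; exists n.
by move=> H g E; case: (H g) => // -[n]; rewrite E eqxx.
Qed.

(** Only the bits placed at representatives are read, so the result is constant on
    cosets. *)
Definition spread (c : nat -> bool) : nat -> bool :=
  fun n => let: (h, i, k) := dec n in c (enc (rep i h, i, k)).

Lemma spread_enc c h i k : spread c (enc (h, i, k)) = c (enc (rep i h, i, k)).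
Proof. by rewrite /spread encK. Qed.

(** The effect of right translation by [g] on the representatives; the other
    indices are fixed, which keeps the map injective on all of [nat]. *)
Definition rep_perm (g : G) (n : nat) : nat :=
  let: (h, i, k) := dec n in
  if rep i h == h then enc (rep i (h * g)%g, i, k) else n.

Lemma rep_perm_inj g : injective (rep_perm g).
Proof.
move=> m n; rewrite -(decK m) -(decK n); case: (dec m) => [[h i] k].
case: (dec n) => [[h' i'] k']; rewrite /rep_perm !encK.
case: eqP => [rh|nrh]; case: eqP => [rh'|nrh'] /(can_inj encK)[].
- move=> E Ei Ek; subst i' k'; rewrite -rh -rh'; congr (enc (_, _, _)).
  have := congr1 (fun x => rep i (x * g^-1)%g) E.
  by rewrite /= !repM !mulgK => ->.
- by move=> E Ei _; case: nrh'; rewrite -E -Ei repK.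
- by move=> E Ei _; case: nrh; rewrite E Ei repK.
- by move=> -> -> ->.
Qed.

(** Translating coset labels amounts to permuting the independent bits from which
    they are made; this is why the law of the labels is invariant. *)
Lemma shift_spread g c : shift g (spread c) = spread (c \o rep_perm g).
Proof.
apply: eq_enc => h i k; rewrite shift_enc !spread_enc /= /rep_perm encK.
by rewrite repK eqxx repM.
Qed.

Context {d0 : measure_display} {W : measurableType d0} (P : probability W R).
Variable xi : W -> nat -> bool.
Hypothesis fxi : fair_coins P xi.

Definition label (w : W) : nat -> bool := spread (xi w).

Lemma label_enc w h i k : label w (enc (h, i, k)) = xi w (enc (rep i h, i, k)).
Proof. by rewrite /label spread_enc. Qed.

Lemma measurable_label n : measurable_fun setT (label ^~ n).
Proof.
by rewrite -(decK n); case: (dec n) => [[h i] k]; under eq_fun do rewrite label_enc;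
  exact: fxi.1.
Qed.

(** A sequence fixed by the shift by [g <> 1] has equal bits at [1] and [g] in every
    layer [k] of the family of index 0, whose cosets are single elements.  Almost
    surely some layer shows the pattern true, false instead. *)
Lemma label_free : {ae P, forall w, free_conf (label w)}.
Proof.
apply: countable_ae => // g; have [->|g1] := eqVneq g 1%g; first exact: aeW.
pose M k := [:: (enc (1%g, 0, k), true); (enc (g, 0, k), false)]%N.
have := @fair_coins_pattern_occurs _ _ _ _ _ M 2 fxi.
have uM k : uniq (map fst (M k)).
  by rewrite /= andbT inE (can_eq encK) !xpair_eqE !eqxx !andbT eq_sym.
have dM m n j : j \in map fst (M m) -> j \in map fst (M n) -> m = n.
  rewrite !inE => /orP[]/eqP-> /orP[];
    by rewrite (can_eq encK) !xpair_eqE => /andP[_ /eqP].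
move=> /(_ (fun=> erefl) uM dM); apply: filterS => w [k Mk] E; exfalso.
have := congr1 (fun c => c (enc (1%g, 0, k)%N)) E.
rewrite shift_enc mul1g !label_enc !rep0.
have /= -> := Mk (enc (1%g, 0, k)%N, true) (mem_head _ _).
by have /= -> := Mk (enc (g, 0, k)%N, false); rewrite // !inE eqxx orbT.
Qed.

Lemma label_mark g i k :
  P [set w | forall b, (b < k)%N -> label w (enc (g, i, b))] = (2^-1 ^+ k)%:E.
Proof.
pose l := [seq (enc (rep i g, i, b), true) | b <- iota 0 k].
have [_ fb] := fxi.
have := fb l; rewrite /l -map_comp size_map size_iota => <-.
  congr (P _); apply/seteqP; split=> w H.
    move=> _ /mapP[b + ->] /=; rewrite mem_iota add0n => /= bk.
    by have := H b bk; rewrite label_enc => ->.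
  move=> b bk; rewrite label_enc.
  by rewrite (H (enc (rep i g, i, b), true))//; apply: map_f; rewrite mem_iota.
by rewrite map_inj_uniq ?iota_uniq// => b b' /(can_inj encK)[].
Qed.

Lemma label_recur i k (g : nat -> G) : injective (rep i \o g) ->
  {ae P, forall w, exists l, forall b, (b < k)%N -> label w (enc (g l, i, b))}.
Proof.
move=> gI.
pose M l := [seq (enc (rep i (g l), i, b), true) | b <- iota 0 k].
have := @fair_coins_pattern_occurs _ _ _ _ _ M k fxi.
have sM l : size (M l) = k by rewrite size_map size_iota.
have uM l : uniq (map fst (M l)).
  by rewrite -map_comp map_inj_uniq ?iota_uniq// => b b' /(can_inj encK)[].
have dM m n j : j \in map fst (M m) -> j \in map fst (M n) -> m = n.
  rewrite -!map_comp => /mapP[b _ ->] /mapP[b' _ /(can_inj encK)[E _]].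
  exact: gI.
move=> /(_ sM uM dM); apply: filterS => w [l H]; exists l => b bk.
rewrite label_enc (H (enc (rep i (g l), i, b), true))//.
by apply: map_f; rewrite mem_iota.
Qed.

(** The measure is the law of [label], carried to the space of free sequences by
    sending the null set of samples with a non-free sequence to a fixed point. *)
Lemma exists_labelled_action_enc : exists (d : measure_display)
    (X : measurableType d) (mu : probability X R) (act : G -> X -> X)
    (code : X -> R) (lab : X -> G -> nat -> nat -> bool),
  labelled_action rep mu act code lab.
Proof.
have [w0 fw0] : exists w, free_conf (label w).
  case: label_free => N [mN N0 subN]; apply: contrapT => nf.
  have NT : N = setT.
    by apply/seteqP; split=> // w _; apply: subN => fw; apply: nf; exists w.
  by move: N0; rewrite NT probability_setT => /eqP; rewrite onee_eq0.
pose pt : {c | free_conf c} := exist _ _ fw0.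
pose X := @borel_bitspace R free_conf pt.
pose Theta (w : W) : X := match pselect (free_conf (label w)) with
  | left fw => exist _ _ fw | right _ => pt end.
have ThetaE w : free_conf (label w) -> proj1_sig (Theta w) = label w.
  by rewrite /Theta; case: pselect.
have mTheta : measurable_fun setT Theta.
  apply: measurable_to_bitspace => n.
  rewrite (_ : (fun w => _) = (fun w => if `[<free_conf (label w)>] then label w n
     else proj1_sig pt n)).
    apply: measurable_fun_ifT => //; last exact: measurable_label.
    apply: (measurable_fun_bool true); rewrite setTI.
    rewrite (_ : _ @^-1` _ = [set w | free_conf (label w)]).
      exact: measurable_free_conf measurable_label.
    by apply/seteqP; split=> w /= /asboolP.
  by apply/funext => w; rewrite /Theta; case: pselect => fw; case: asboolP.
have [mu muE] := pushforward_probability P mTheta.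
have mu_eq (A : set X) (B : set W) : measurable A -> measurable B ->
    (forall w, free_conf (label w) -> A (Theta w) <-> B w) -> mu A = P B.
  move=> mA mB AB; rewrite muE.
  apply: (probability_ae_eq _ mB label_free) => //.
  by rewrite -[X in measurable X]setTI; exact: mTheta.
have mu_ae (Q : X -> Prop) : measurable [set x | Q x] ->
    {ae P, forall w, free_conf (label w) -> Q (Theta w)} -> {ae mu, forall x, Q x}.
  move=> mQ aeQ; apply: ae_of_null => //; rewrite muE.
  have Q' : {ae P, forall w, Q (Theta w)}.
    by apply: (filterS _ (filterI aeQ label_free)) => w [Qw fw]; exact: Qw.
  rewrite -(measure0 P); apply: (probability_ae_eq _ _ Q') => //.
  rewrite -[X in measurable X]setTI; apply: mTheta => //.
  exact: measurableC.
pose act (g : G) (x : X) : X := exist _ _ (@free_shift g _ (proj2_sig x)).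
pose lab (x : X) (g : G) (i n : nat) := proj1_sig x (enc (g, i, n)).
have valI (x y : X) : proj1_sig x = proj1_sig y -> x = y.
  move: x y => [c fc] [c' fc'] /= cc; subst c'; congr exist; exact: Prop_irrelevance.
have mlab g i n : measurable_fun setT (fun x => lab x g i n) by exact: measurable_coord.
exists _, X, mu, act, (@code R _ pt), lab; split.
- apply: standard_borel_bitspace; exact: measurable_free_conf measurable_digits.
- have mact g : measurable_fun setT (act g).
    apply: measurable_to_bitspace => n; rewrite -(decK n).
    case: (dec n) => [[h i] k] /=.
    by under eq_fun do rewrite shift_enc; exact: measurable_coord.
  split=> //.
  + by move=> x; apply: valI; rewrite /= shift1.
  + by move=> g h x; apply: valI; rewrite /= shiftM.
  move=> g A mA; have [nu nuE] := pushforward_probability mu (mact g).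
  rewrite -nuE; apply: bitspace_law_unique mA => l; rewrite nuE.
  have ml (z : W -> nat -> bool) : (forall n, measurable_fun setT (z ^~ n)) ->
      measurable ((spread \o z) @^-1` cylinder l).
    move=> mz; apply: (@measurable_cylinder _ _ (spread \o z)) => n /=.
    rewrite -(decK n).
    by case: (dec n) => [[h i] k]; under eq_fun do rewrite spread_enc; exact: mz.
  have mX : measurable (@proj1_sig _ _ @^-1` cylinder l : set X).
    by apply: measurable_cylinder; exact: measurable_coord.
  have fb := fxi; have fb' := fair_coins_reindex fb (@rep_perm_inj g).
  have -> : mu (@proj1_sig _ _ @^-1` cylinder l) = P ((spread \o xi) @^-1` cylinder l).
    apply: mu_eq => //; first by apply: ml => n; exact: fxi.1.
    by move=> w fw; rewrite /= ThetaE.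
  have -> : mu (act g @^-1` (@proj1_sig _ _ @^-1` cylinder l)) =
      P ((spread \o (fun w n => xi w (rep_perm g n))) @^-1` cylinder l).
    apply: mu_eq.
    + by rewrite -[X in measurable X]setTI; exact: mact.
    + by apply: ml => n; exact: fxi.1.
    + by move=> w fw; rewrite /= ThetaE// /label shift_spread.
  pose l' := [seq (let: (h, i, k) := dec p.1 in enc (rep i h, i, k), p.2) | p <- l].
  (* The event is a cylinder of the underlying bits, in which coordinates may repeat. *)
  have cylE (z : W -> nat -> bool) :
      (spread \o z) @^-1` cylinder l = z @^-1` cylinder l'.
    apply/seteqP; split=> w H.
      by move=> _ /mapP[p pl ->]; rewrite -(H p pl) /= /spread; case: (dec p.1) => [[]].
    move=> p pl; have := H _ (map_f _ pl).
    by rewrite /= /spread; case: (dec p.1) => [[]].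
  by rewrite !cylE; exact: fair_coins_law.
- by move=> g [c fc] /(congr1 (@proj1_sig _ _)) /= /fc.
- exact: measurable_code.
- exact: code_inj.
- exact: mlab.
- by move=> g x h i n; rewrite /lab /= shift_enc.
- move=> g h i n gh; apply: mu_ae.
    exact: measurable_eq_bool.
  by apply: aeW => w fw; rewrite /lab ThetaE// !label_enc gh.
- move=> g i k; rewrite -(label_mark g i k); apply: mu_eq.
  + exact: (@measurable_all_lt _ X (fun n x => lab x g i n)).
  + apply: (@measurable_all_lt _ W (fun n w => label w (enc (g, i, n)))) => n.
    exact: measurable_label.
  + by move=> w fw; rewrite /= /lab ThetaE.
- move=> i k g gI; apply: mu_ae.
    apply: countable_measurableU => // l.
    exact: (@measurable_all_lt _ X (fun n x => lab x (g l) i n)).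
  by apply: filterS (label_recur k gI) => w [l H] fw; exists l; rewrite /lab ThetaE.
Qed.

End Shift.

Lemma countable_enum (G : groupType) : countable [set: G] ->
  exists (enc : G * nat * nat -> nat) (dec : nat -> G * nat * nat),
    cancel enc dec /\ cancel dec enc.
Proof.
move=> cG; pose J := (G * nat * nat)%type.
have cJ : countable [set: J].
  by apply: countable_setT_prod => //; exact: countable_setT_prod.
have iJ : infinite_set [set: J].
  move=> /(finite_image snd); rewrite (_ : _ @` _ = [set: nat]).
    exact: infinite_nat.
  by apply/seteqP; split=> // n _; exists (1%g, 0%N, n).
have /card_set_bijP[f [_ injf surjf]] := eq_card_nat cJ iJ.
have [dec fK decK] : bijective f by rewrite -setTT_bijective.
by exists f, dec.
Qed.

Theorem exists_labelled_action (R : realType) (G : groupType)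
    (rep : nat -> G -> G) : countable [set: G] ->
  (forall g, rep 0 g = g) -> (forall i g, rep i (rep i g) = rep i g) ->
  (forall i g h, rep i (rep i g * h)%g = rep i (g * h)%g) ->
  exists (d : measure_display) (X : measurableType d) (mu : probability X R)
    (act : G -> X -> X) (code : X -> R) (lab : X -> G -> nat -> nat -> bool),
    labelled_action rep mu act code lab.
Proof.
move=> cG rep0 repK repM; have [enc [dec [encK decK]]] := countable_enum cG.
by apply: (exists_labelled_action_enc (enc := enc) (dec := dec) _ _ _ _ _ _
  (uniform_fair_coins R)).
Qed.

(** * Subgroups, cosets and words *)

Section Subgroups.
Variable G : groupType.
Implicit Types (S H : set G) (g x y : G).

Lemma generated_subgroup S : is_subgroup (generated S).
Proof.
split=> [H [[]]|x y Sx Sy H SH|x Sx H SH] //; have [[H1 HM HV] _] := SH.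
  by apply: HM; [exact: Sx|exact: Sy].
by apply: HV; exact: Sx.
Qed.

Lemma sub_generated S : S `<=` generated S.
Proof. exact: sub_gen_smallest. Qed.

Lemma generated_min S H : is_subgroup H -> S `<=` H -> generated S `<=` H.
Proof. by move=> sH SH; exact: smallest_sub. Qed.

Lemma subgroupX H x n : is_subgroup H -> H x -> H (x ^+ n)%g.
Proof. by move=> [H1 HM _] Hx; elim: n => // n IH; rewrite expgS; exact: HM. Qed.

Section IntMorphism.
Variables (H : set G) (phi : G -> int).
Hypothesis sH : is_subgroup H.
Hypothesis phiM : forall x y, H x -> H y -> phi (x * y)%g = phi x + phi y.

Lemma int_morph1 : phi 1%g = 0.
Proof. by case: sH => H1 _ _; have := phiM H1 H1; rewrite mul1g; lia. Qed.

Lemma int_morphV x : H x -> phi (x^-1)%g = - phi x.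
Proof.
move=> Hx; case: sH => _ _ HV; have := phiM Hx (HV _ Hx).
by rewrite mulgV int_morph1; lia.
Qed.

Lemma int_morphX x n : H x -> phi (x ^+ n)%g = n%:Z * phi x.
Proof.
move=> Hx; elim: n => [|n IH]; first by rewrite expg0 int_morph1 mul0r.
by rewrite expgS phiM ?IH//; [lia|exact: subgroupX].
Qed.

Lemma int_morph_ker : is_subgroup [set g | H g /\ phi g = 0].
Proof.
case: (sH) => H1 HM HV; split=> [|x y [Hx x0] [Hy y0]|x [Hx x0]].
- by split=> //; exact: int_morph1.
- by split; [exact: HM|rewrite phiM// x0 y0].
- by split; [exact: HV|rewrite int_morphV// x0].
Qed.

End IntMorphism.

(** The choice depends only on the set of elements equivalent to [g], hence only on
    the coset. *)
Lemma exists_coset_rep (K : nat -> set G) : (forall i, is_subgroup (K i)) ->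
  exists rep : nat -> G -> G,
    (forall i g, K i (g * (rep i g)^-1)%g) /\
    (forall i g h, rep i g = rep i h <-> K i (g * h^-1)%g).
Proof.
move=> sK; pose C i g := [set h | K i (g * h^-1)%g].
pose rep i g := xget 1%g (C i g).
have repK i g : K i (g * (rep i g)^-1)%g.
  have [K1 _ _] := sK i.
  by apply: (@xgetI _ 1%g (C i g) g); rewrite /C /= mulgV.
exists rep; split=> // i g h; have [K1 KM KV] := sK i; split=> [E|gh].
  have := KM _ _ (repK i g) (KV _ (repK i h)).
  by rewrite E invgF mulgA mulgVK.
congr xget; apply/seteqP; split=> u /= Ku.
  have := KM _ _ (KV _ gh) Ku.
  by rewrite invgF mulgA mulgVK.
by have := KM _ _ gh Ku; rewrite mulgA mulgVK.
Qed.

End Subgroups.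

Section Words.
Variable G : groupType.
Implicit Types (w : seq G).

Lemma size_word_path w : size (word_path w) = (size w).+1.
Proof. by rewrite /word_path /= size_scanl size_rev. Qed.

Lemma word_val_cons a w : word_val (a :: w) = (a * word_val w)%g.
Proof. by rewrite /word_val big_cons. Qed.

Lemma word_val_cat w1 w2 : word_val (w1 ++ w2) = (word_val w1 * word_val w2)%g.
Proof. by rewrite /word_val big_cat. Qed.

Lemma nth_word_path w k : (k <= size w)%N ->
  nth 1%g (word_path w) k = word_val (drop (size w - k) w).
Proof.
case: k => [|k] kw; first by rewrite subn0 drop_size /word_val big_nil.
rewrite /word_path /= nth_scanl ?size_rev// take_rev foldl_rev.
by rewrite /word_val; elim: (drop _ _) => [|a u IH]; rewrite ?big_nil// big_cons /= IH.
Qed.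

Lemma word_path_step w k : (k < size w)%N -> exists2 a, a \in w &
  nth 1%g (word_path w) k.+1 = (a * nth 1%g (word_path w) k)%g.
Proof.
move=> kw; exists (nth 1%g w (size w - k.+1)).
  by apply: mem_nth; rewrite -subn_gt0 subKn.
rewrite !nth_word_path ?(ltnW kw)// (drop_nth 1%g); last by rewrite -subn_gt0 subKn.
by rewrite word_val_cons subnSK.
Qed.

Lemma path_stepsP w (g h : G) : reflect
  (exists2 k, (k < size w)%N &
     nth 1%g (word_path w) k = g /\ nth 1%g (word_path w) k.+1 = h)
  ((g, h) \in path_steps (word_path w)).
Proof.
have sz : size (path_steps (word_path w)) = size w.
  by rewrite size_zip size_behead size_word_path /=; lia.
apply: (iffP (nthP (1%g, 1%g))) => [[k]|[k kw [<- <-]]].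
  rewrite sz => kw; rewrite nth_zip_cond sz kw nth_behead => -[<- <-].
  by exists k.
exists k; first by rewrite sz.
by rewrite nth_zip_cond sz kw nth_behead.
Qed.

Lemma size_word_pow w m : size (word_pow w m) = (m * size w)%N.
Proof.
by elim: m => //= m IH; rewrite /word_pow /= size_cat -/(word_pow w m) IH mulSn.
Qed.

Lemma word_val_pow w m : word_val (word_pow w m) = (word_val w ^+ m)%g.
Proof.
elim: m => [|m IH]; first by rewrite /word_val big_nil expg0.
by rewrite /word_pow /= word_val_cat -/(word_pow w m) IH expgS.
Qed.

Lemma drop_word_pow w i m : (i <= m)%N ->
  drop ((m - i) * size w) (word_pow w m) = word_pow w i.
Proof.
elim: m => [|m IH]; first by rewrite leqn0 => /eqP->.
rewrite leq_eqVlt => /orP[/eqP->|im]; first by rewrite subnn mul0n drop0.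
rewrite subSn// mulSn /word_pow /= drop_cat ltnNge leq_addr /= addKn.
exact: IH.
Qed.

Lemma nth_word_path_pow w m i : (i <= m)%N ->
  nth 1%g (word_path (word_pow w m)) (i * size w) = (word_val w ^+ i)%g.
Proof.
move=> im; rewrite nth_word_path size_word_pow; last by rewrite leq_mul2r im orbT.
by rewrite -mulnBl drop_word_pow// word_val_pow.
Qed.

Section Embedded.
Variables (w : seq G) (m : nat).
Hypothesis emb : embedded_relation (word_pow w m).
Hypothesis w_gt0 : (0 < size w)%N.

Lemma embedded_word_valX : (word_val w ^+ m)%g = 1%g.
Proof.
have [last1 _] := emb; rewrite -(nth_word_path_pow w (leqnn m)) -[RHS]last1.
by rewrite -nth_last size_word_path size_word_pow.
Qed.

Lemma embedded_word_val_neq1 i : (0 < i < m)%N -> (word_val w ^+ i)%g != 1%g.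
Proof.
move=> /andP[i0 im]; apply/eqP => E; have [_ inj] := emb.
have := inj 0%N (i * size w)%N.
rewrite nth_word_path_pow ?(ltnW im)// E size_word_path size_word_pow.
rewrite muln_gt0 i0 w_gt0 ltnS leq_mul2r (ltnW im) orbT => /(_ isT erefl)[_ /=] /eqP.
by rewrite eqn_mul2r gtn_eqF//= ltn_eqF.
Qed.

End Embedded.
End Words.

(** * Well-founded descent along a positive system *)

Section Descent.
Variables (G : groupType) (X : Type) (act : G -> X -> X) (A X0 : set X).

(** [descent y x] says that the removed edge at [y] may lie on the cycle through [x]:
    it has to be reconnected before the one at [x]. *)
Definition descent (T : set G) (y x : X) : Prop :=
  [/\ A y, A x & exists2 g, T g & y = act g x].

Lemma descent_sub (T T' : set G) x : T `<=` T' ->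
  Acc (descent T') x -> Acc (descent T) x.
Proof.
move=> TT'; elim=> {}x _ IH; constructor => y [Ay Ax [g Tg yx]].
by apply: IH; split=> //; exists g => //; exact: TT'.
Qed.

Hypothesis X0_act : forall g x, X0 x -> X0 (act g x).

(** Let the marks of [x] be read along the powers of [h].  A step by [g \in T]
    shifts the marks by [phi g], between 0 and [N]; since points of [A] have no mark
    at the positions below [N], a mark at position [p] stays at a nonnegative
    position, namely [p - phi g].  So lexicographic induction applies, first on the
    position of a mark and then, for steps with [phi g = 0], on the relation assumed
    to be well founded. *)
Lemma descent_layer (H T : set G) (phi : G -> int) (h : G) (N : nat)
    (mark : X -> G -> Prop) :
  is_subgroup H ->
  (forall x y, H x -> H y -> phi (x * y)%g = phi x + phi y) ->
  T `<=` H -> H h -> phi h = 1 ->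
  (forall g, T g -> 0 <= phi g <= N%:Z) ->
  (forall g x u, mark (act g x) u <-> mark x (u * g)%g) ->
  (forall x k u, X0 x -> H k -> phi k = 0 -> mark x u -> mark x (k * u)%g) ->
  (forall x, X0 x -> exists l, mark x (h ^+ l)%g) ->
  (forall x l, A x -> (l < N)%N -> ~ mark x (h ^+ l)%g) ->
  (forall x, X0 x -> Acc (descent [set g | T g /\ phi g = 0]) x) ->
  forall x, X0 x -> Acc (descent T) x.
Proof.
move=> sH phiM TH Hh phih phiT markE markK recur noMark acc0.
have [H1 HM HV] := sH.
have moveMark x g l p : X0 x -> T g -> mark x (h ^+ p)%g ->
    p%:Z = l%:Z + phi g -> mark (act g x) (h ^+ l)%g.
  move=> x0 Tg mx pl; have Hg := TH _ Tg; apply/markE.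
  have Hl q : H (h ^+ q)%g by exact: subgroupX.
  rewrite -[X in mark x X](mulgVK (h ^+ p)%g); apply: markK => //.
    by apply: (HM _ _ (HM _ _ (Hl l) Hg)); exact: HV.
  rewrite !phiM//; last 2 first.
  - exact: HM.
  - exact: HV.
  by rewrite (int_morphV sH phiM)// !(int_morphX sH phiM)// phih; lia.
suff: forall p x, X0 x -> mark x (h ^+ p)%g -> Acc (descent T) x.
  by move=> acc x x0; have [l] := recur _ x0; exact: acc.
elim/ltn_ind => p IHp x x0; have ax := acc0 _ x0; elim: ax x0 => {}x _ IHx x0 mx.
constructor => y [Ay Ax [g Tg yx]]; have /andP[g0 gN] := phiT _ Tg.
have y0 : X0 y by rewrite yx; exact: X0_act.
(* A step with phi g = 0 leaves the mark in place, any other moves it to the left. *)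
have [gz|gnz] := eqVneq (phi g) 0.
  apply: IHx => //; first by split=> //; exists g.
  by rewrite yx; apply: moveMark mx _ => //; rewrite gz addr0.
have Np : (N <= p)%N by rewrite leqNgt; apply/negP => /(noMark _ _ Ax).
have pq : p%:Z = (p - `|phi g|)%N%:Z + phi g by lia.
apply: (IHp (p - `|phi g|)%N) y0 _; first by lia.
by rewrite yx; exact: moveMark mx pq.
Qed.

Lemma positive_system_sub (P : set G) L Pi phi i : positive_system P L Pi phi ->
  (1 <= i <= L)%N -> Pi i `<=` P.
Proof.
move=> ps /andP[i1 iL]; case: i i1 iL => // -[|i] _ iL; first by rewrite (ps_first ps).
by rewrite (ps_next ps)// => g [].
Qed.

(** One application of [descent_layer] per level, from the last level, where no
    element of [P] is left in the kernel, back to the first. *)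
Lemma positive_system_descent (P : set G) (L : nat) (Pi : nat -> set G)
    (phi : nat -> G -> int) (h : nat -> G) (N : nat) (mark : nat -> X -> G -> Prop) :
  positive_system P L Pi phi ->
  (forall i, (1 <= i <= L)%N -> generated (Pi i) (h i) /\ phi i (h i) = 1) ->
  (forall i g, (1 <= i <= L)%N -> Pi i g -> phi i g <= N%:Z) ->
  (forall i g x u, mark i (act g x) u <-> mark i x (u * g)%g) ->
  (forall i x k u, (1 <= i <= L)%N -> X0 x -> generated (Pi i) k -> phi i k = 0 ->
     mark i x u -> mark i x (k * u)%g) ->
  (forall i x, (1 <= i <= L)%N -> X0 x -> exists l, mark i x (h i ^+ l)%g) ->
  (forall i x l, (1 <= i <= L)%N -> A x -> (l < N)%N -> ~ mark i x (h i ^+ l)%g) ->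
  forall x, X0 x -> Acc (descent P) x.
Proof.
move=> ps hP NP markE markK recur noMark.
suff: forall j i, (1 <= i)%N -> (i + j = L)%N ->
    forall x, X0 x -> Acc (descent (Pi i)) x.
  move=> /(_ L.-1 1%N isT); rewrite (ps_first ps); apply.
  by rewrite add1n prednK// (ps_length ps).
have layer i : (1 <= i <= L)%N ->
    (forall x, X0 x -> Acc (descent [set g | Pi i g /\ phi i g = 0]) x) ->
    forall x, X0 x -> Acc (descent (Pi i)) x.
  move=> iL; have [Hh ph] := hP _ iL.
  apply: (@descent_layer (generated (Pi i)) _ (phi i) (h i) N (mark i)) => //.
  - exact: generated_subgroup.
  - exact: (ps_morph ps).
  - exact: sub_generated.
  - by move=> g Pg; rewrite (ps_ge0 ps)//= NP.
  - by move=> x k u; exact: markK.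
  - by move=> x; exact: recur.
  - by move=> x l; exact: noMark.
elim=> [|j IH] i i1 ij; (apply: layer; first by rewrite i1/= -ij leq_addr) => x x0.
  have -> : [set g | Pi i g /\ phi i g = 0] = set0; last by constructor => y [_ _ []].
  rewrite addn0 in ij; subst i; have iL : (1 <= L <= L)%N by rewrite i1 leqnn.
  apply/seteqP; split=> // g [Pg g0]; rewrite -(ps_last ps).
  split; first exact: (positive_system_sub ps iL).
  by split=> //; exact: sub_generated.
apply: (descent_sub _ (IH i.+1 _ _ _ x0)) => //; last by rewrite addSnnS.
have iL : (1 <= i < L)%N by lia.
rewrite (ps_next ps)// => g [Pg g0]; split.
  by apply: (positive_system_sub ps _ Pg); lia.
by split=> //; exact: sub_generated.
Qed.

End Descent.

(** * Reconnecting removed edges along a cycle *)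

Section Reconnect.
Context {d} {X : measurableType d} {G : groupType}.
Variables (act : G -> X -> X) (S : set G) (s : G) (w : seq G) (m : nat).
Hypotheses (act1 : forall x, act 1%g x = x)
  (actM : forall g h x, act (g * h)%g x = act g (act h x))
  (act_free : free_action act).
Hypotheses (wS : is_word S w) (m_gt0 : (0 < m)%N)
  (emb : embedded_relation (word_pow w m)) (genS : generated S = setT).
Variables (A X0 : set X).
Hypothesis X0_act : forall g x, X0 x -> X0 (act g x).

Local Notation W := (word_pow w m).
Local Notation v := (nth 1%g (word_path W)).
Local Notation Q := (step_set W s).
Local Notation powers := [set (word_val w ^+ i)%g | i in `I_m].
Local Notation E := (schreier act S `\` edges_over act s A).

Hypothesis powQ : powers `<=` Q.
Hypothesis sep : forall x i, A x -> (0 < i < m)%N -> ~ A (act (word_val w ^+ i)%g x).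
Hypothesis acc : forall x, X0 x -> Acc (descent act A (Q `\` powers)) x.
Hypothesis size_neq2 : size W <> 2%N.

Definition linked : X -> X -> Prop := clos_refl_trans X (fun x y => E (x, y)).

Lemma linked_trans y x z : linked x y -> linked y z -> linked x z.
Proof. exact: rt_trans. Qed.

Lemma linked_sym x y : linked x y -> linked y x.
Proof.
elim=> [{}x {}y|{}x|{}x {}y z _ yx _ zy].
- move=> [[/= xy [z [t [St zt]]]] nA]; apply: rt_step; split.
    split; first by move=> /= /esym.
    by exists z, t; split=> //; case: zt => -[-> ->]; [right|left].
  move=> [z' Az' [] [z1 z2]]; apply: nA; exists z' => //; [right|left];
    by rewrite z1 z2.
- exact: rt_refl.
- exact: linked_trans zy yx.
Qed.

Lemma act_inj x : injective (act^~ x).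
Proof.
move=> g h gh; have : act (h^-1 * g)%g x = x by rewrite actM gh -actM mulVg act1.
by move=> /act_free E'; rewrite -[g](mulVKg h) E' mulg1.
Qed.

Lemma wordS_pow a : a \in W -> S a \/ S (a^-1)%g.
Proof. by move=> /flattenP[u /nseqP[-> _]]; exact: wS. Qed.

Lemma linked_range x i j : (i <= j)%N ->
  (forall k, (i <= k < j)%N -> linked (act (v k) x) (act (v k.+1) x)) ->
  linked (act (v i) x) (act (v j) x).
Proof.
elim: j => [|j IH]; first by rewrite leqn0 => /eqP-> _; exact: rt_refl.
rewrite leq_eqVlt => /orP[/eqP->|]; first by move=> _; exact: rt_refl.
rewrite ltnS => ij H; apply: linked_trans (H j _); last by rewrite ij ltnSn.
by apply: IH => // k /andP[ik kj]; apply: H; rewrite ik ltnS ltnW.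
Qed.

(** If this edge of the cycle is removed, it is the removed edge at [g x] for some
    [g \in Q], and [g <> 1] by the last two hypotheses.  Then [g] is not a power of
    [w] by [sep], so that [g x] precedes [x] in the descent relation. *)
Lemma linked_cycle_step x k : A x ->
  (forall y, descent act A (Q `\` powers) y x -> linked y (act s y)) ->
  (k < size W)%N -> (v k, v k.+1) <> (1%g, s) -> (v k, v k.+1) <> (s, 1%g) ->
  linked (act (v k) x) (act (v k.+1) x).
Proof.
move=> Ax IH kW n1s ns1.
have [a aW vk1] := word_path_step kW.
have other g : Q g -> g <> 1%g -> A (act g x) ->
    linked (act g x) (act s (act g x)).
  move=> Qg g1 Ag; apply: IH; split=> //; exists g => //; split=> // -[i /= im wi].
  apply: (sep Ax _ (i := i)); last by rewrite wi.
  by rewrite im andbT lt0n; apply/eqP => i0; apply: g1; rewrite -wi i0.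
have [e|ne] := pselect (act (v k) x = act (v k.+1) x).
  by rewrite e; exact: rt_refl.
have [[y Ay [[e1 e2]|[e1 e2]]]|nE] :=
    pselect (edges_over act s A (act (v k) x, act (v k.+1) x)).
- have vks : v k = (s * v k.+1)%g by apply: (@act_inj x); rewrite actM e2.
  rewrite e1 -e2; apply: linked_sym; apply: other.
  + by right; apply/path_stepsP; exists k.
  + by move=> v1; apply: ns1; rewrite vks v1 mulg1.
  + by rewrite e2.
- have vks : v k.+1 = (s * v k)%g by apply: (@act_inj x); rewrite actM e1.
  rewrite e2 -e1; apply: other.
  + by left; apply/path_stepsP; exists k.
  + by move=> v1; apply: n1s; rewrite vks v1 mulg1.
  + by rewrite e1.
apply: rt_step; split=> //; split=> //.
have [Sa|Sa] := wordS_pow aW.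
  by exists (act (v k) x), a; split=> //; right; rewrite vk1 actM.
exists (act (v k.+1) x), (a^-1)%g; split=> //; left.
by rewrite vk1 -actM mulKg.
Qed.

(** The edge between [x] and [s x] is the first or the last edge of the cycle through
    [x], according to the direction in which it is traversed, and occurs only once;
    the other edges form a path from one endpoint to the other. *)
Lemma linked_removed x : X0 x -> A x -> linked x (act s x).
Proof.
move=> x0; have ax := acc x0; elim: ax x0 => {}x _ IH x0 Ax.
have {}IH y : descent act A (Q `\` powers) y x -> linked y (act s y).
  move=> yx; have [Ay _ [g _ yE]] := yx.
  by apply: IH => //; rewrite yE; exact: X0_act.
have [->|/eqP s1] := eqVneq s 1%g; first by rewrite act1; exact: rt_refl.
have [last1 inj] := emb.
have vn : v (size W) = 1%g by rewrite -[RHS]last1 -nth_last size_word_path.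
have v_eq i j : (i < j <= size W)%N -> v i = v j -> i = 0%N /\ j = size W.
  move=> /andP[ij jW] e; have := inj i j; rewrite size_word_path ltnS ij jW.
  by move=> /(_ isT e).
have Q1 : Q 1%g by apply: powQ; exists 0%N.
case: Q1 => /path_stepsP[k kW]; rewrite mulg1 => -[vk vk1].
- have k0 : k = 0%N.
    apply/eqP; rewrite -leqn0 leqNgt; apply/negP => k_gt0.
    have [] := v_eq 0%N k; rewrite ?k_gt0 ?(ltnW kW) ?vk//.
    by move=> _ e; rewrite e ltnn in kW.
  subst k; apply: linked_sym.
  rewrite -[x in linked _ x]act1 -vn -vk1; apply: linked_range => // k /andP[k1 kn].
  apply: linked_cycle_step => // -[e1 e2].
  + have [] := v_eq 0%N k; rewrite ?k1 ?(ltnW kn)//.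
    by move=> _ e; rewrite e ltnn in kn.
  + have [] := v_eq 0%N k.+1; rewrite ?kn// => _ kn'.
    have [k1'|k1'] := eqVneq 1%N k; first by apply: size_neq2; rewrite -kn' -k1'.
    have [] // := v_eq 1%N k; last by rewrite vk1 e1.
    by rewrite ltn_neqAle k1' k1 ltnW.
- have kn : k.+1 = size W.
    by have [] := v_eq 0%N k.+1; rewrite ?kW ?vk1.
  rewrite -[x in linked x _]act1 -[1%g]/(v 0%N) -vk.
  apply: linked_range => // l /andP[_ lk].
  have lW : (l < size W)%N by exact: ltn_trans kW.
  apply: linked_cycle_step => // -[e1 e2].
  + have l0 : l = 0%N.
      apply/eqP; rewrite -leqn0 leqNgt; apply/negP => l_gt0.
      have [] := v_eq 0%N l; rewrite ?l_gt0 ?(ltnW lW) ?e1//.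
      by move=> _ e; rewrite e ltnn in lW.
    subst l; have [k1|k1] := eqVneq 1%N k; first by apply: size_neq2; rewrite -kn -k1.
    have [] // := v_eq 1%N k; last by rewrite vk -e2.
    by rewrite ltn_neqAle k1 lk ltnW.
  + have [] := v_eq 0%N l.+1; rewrite ?lW ?e2//.
    by move=> _ e; move: lk; rewrite -ltnS kn e ltnn.
Qed.

Lemma linked_generator x t : X0 x -> S t -> linked x (act t x).
Proof.
move=> x0 St; have [e|ne] := pselect (x = act t x).
  by rewrite -e; exact: rt_refl.
have [[y Ay [[e1 e2]|[e1 e2]]]|nE] := pselect (edges_over act s A (x, act t x)).
- rewrite e2 e1; apply: linked_sym; apply: linked_removed => //.
  by rewrite -e2; exact: X0_act.
- by rewrite e2 -e1; apply: linked_removed => //; rewrite e1.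
by apply: rt_step; split=> //; split=> //; exists x, t; split=> //; right.
Qed.

Lemma component_orbit x : X0 x -> graph_component E x = act_orbit act x.
Proof.
move=> x0; apply/seteqP; split=> y.
  move=> {x0}; elim=> [{}x {}y [[_ [z [t [St [[-> ->]|[-> ->]]]]]] _]|{}x|
                       {}x {}y z _ [g _ <-] _ [h _ <-]].
  - by exists (t^-1)%g => //; rewrite -actM mulVg act1.
  - by exists t.
  - by exists 1%g.
  - by exists (h * g)%g.
move=> [g _ <-].
suff: [set g | forall x, X0 x -> linked x (act g x)] g by move=> H; exact: H.
have : generated S g by rewrite genS.
apply: generated_min; last by move=> t St z z0; exact: linked_generator.
split=> [z _|a b Ha Hb z z0|a Ha z z0]; first by rewrite act1; exact: rt_refl.
- by rewrite actM; apply: linked_trans (Hb _ z0) (Ha _ _); exact: X0_act.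
apply: linked_sym; rewrite -{2}[z]act1 -(mulgV a) actM.
by apply: Ha; exact: X0_act.
Qed.

End Reconnect.

(** On a cycle of length 2 the complement of an edge is the same edge.  There, [Q]
    would be contained in [{1, s}] with [s] of order at most 2, and the group
    generated by [P] could not map onto the integers. *)
Lemma cycle_length_neq2 (G : groupType) (W : seq G) (s : G) (powers : set G)
    (L : nat) (Pi : nat -> set G) (phi : nat -> G -> int) :
  embedded_relation W -> powers 1%g -> powers `<=` step_set W s ->
  positive_system (step_set W s `\` powers) L Pi phi -> size W <> 2%N.
Proof.
move=> emb pow1 powQ ps W2; have [last1 _] := emb.
pose v := nth 1%g (word_path W); pose u := v 1%N.
have v2 : v 2%N = 1%g by rewrite -[RHS]last1 -nth_last size_word_path W2.
have Qu g : step_set W s g ->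
    (g = 1%g /\ (s * g)%g = u) \/ (g = u /\ (s * g)%g = 1%g).
  move=> [] /path_stepsP[[|[|k]]]; rewrite W2// => _ [].
  - by move=> e0 e1; left; split; apply/esym; [exact: e0|exact: e1].
  - by move=> e1 e2; right; split; apply/esym; [exact: e1|rewrite -v2; exact: e2].
  - by move=> e0 e1; right; split; apply/esym; [exact: e1|exact: e0].
  - by move=> e1 e2; left; split; apply/esym; [rewrite -v2; exact: e2|exact: e1].
have su : s = u.
  have [[_]|[<-]] := Qu _ (powQ _ pow1); rewrite mulg1//.
have Pu g : (step_set W s `\` powers) g -> g = u /\ (u * u)%g = 1%g.
  move=> [/Qu[[g1 _]|[gu sg1]] ng]; first by rewrite g1 in ng.
  by split=> //; rewrite -{1}su -gu.
have [iL1 _] : (1 <= 1 <= L)%N /\ True by rewrite (ps_length ps).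
have [g Pg pg] := ps_surj ps iL1 1; rewrite (ps_first ps) in Pg.
have sub1 : phi 1%N 1%g = 0.
  exact: (int_morph1 (generated_subgroup _) (ps_morph ps iL1)).
have gg : (g * g)%g = 1%g.
  suff: [set h : G | (h * h)%g = 1%g /\ (h = 1%g \/ h = u)] g by case.
  apply: (generated_min _ _ Pg); last first.
    by move=> h /Pu[-> uu]; split=> //; right.
  have U1 : [set h : G | (h * h)%g = 1%g /\ (h = 1%g \/ h = u)] 1%g.
    by split; [rewrite mulg1|left].
  split=> [//|x y [xx [->|xu]] [yy yd]|x [xx x1u]]; first by rewrite mul1g.
  - case: yd => [->|yu]; first by rewrite mulg1; split=> //; right.
    by have -> : (x * y)%g = 1%g by rewrite yu -xu xx.
  - have -> : (x^-1)%g = x by apply: mulg1_eq.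
    by split.
have := ps_morph ps iL1; rewrite (ps_first ps) => /(_ _ _ Pg Pg).
by rewrite gg sub1 pg.
Qed.

(** * Transversals, Borel graphs and the theorem *)

Section Bounds.
Context {R : realType} {d} {X : measurableType d} (mu : probability X R).

Lemma finite_union_bound (I : finType) (F : I -> set X) (c : R) :
  (forall i, measurable (F i)) -> (forall i, (mu (F i) <= c%:E)%E) ->
  (mu [set x | exists i, F i x] <= (#|I|%:R * c)%:E)%E.
Proof.
move=> mF Fc; rewrite cardE.
have -> : [set x | exists i, F i x] = \big[setU/set0]_(i <- enum I) F i.
  rewrite -bigcup_seq; apply/seteqP; split=> x [i]; last by exists i.
  by move=> Fi; exists i => //=; rewrite mem_enum.
elim: (enum I) => [|i l IH]; first by rewrite big_nil measure0 mul0r.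
rewrite big_cons (le_trans (measureU2 _ _ _))//; first exact: bigsetU_measurable.
by rewrite /= -natr1 mulrDl mul1r addrC EFinD leeD.
Qed.

Lemma exists_small_dyadic (C e : R) : 0 <= C -> 0 < e ->
  exists k, C * 2^-1 ^+ k <= e.
Proof.
move=> C0 e0; pose k := (Num.truncn (C / e)).+1; exists k.
have Ck : C / e <= k%:R.
  by have /andP[_ /ltW] := truncn_itv (divr_ge0 C0 (ltW e0)).
rewrite exprVn ler_pdivrMr ?exprn_gt0// mulrC -ler_pdivrMr// (le_trans Ck)//.
by rewrite -natrX ler_nat ltnW// ltn_expl.
Qed.

Variables (G : groupType) (act : G -> X -> X) (code : X -> R).
Hypotheses (pmp : pmp_action mu act) (fr : free_action act)
  (mcode : measurable_fun setT code) (code_inj : injective code).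

(** A Borel transversal of the orbits of a cyclic group of order [m]: each orbit is
    represented by its point of smallest [code]. *)
Definition cyclic_min (g : G) (m : nat) : set X :=
  [set x | forall i, (0 < i < m)%N -> code x < code (act (g ^+ i)%g x)].

Lemma measurable_cyclic_min g m : measurable (cyclic_min g m).
Proof.
apply: countable_measurableI => // i; have [im|nim] := boolP (0 < i < m)%N.
  rewrite [X in measurable X](_ : _ =
    (fun x => code x < code (act (g ^+ i)%g x)) @^-1` [set true]).
    rewrite -[X in measurable X]setTI; apply: measurable_fun_ltr => //.
      apply: (measurableT_comp mcode); exact: (act_measurable pmp).
  by apply/seteqP; split=> x /=; [apply|move=> + _].
by rewrite [X in measurable X](_ : _ = setT)//; apply/seteqP; split.
Qed.

Lemma cyclic_min_separated g m x i : cyclic_min g m x -> (g ^+ m = 1)%g ->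
  (0 < i < m)%N -> ~ cyclic_min g m (act (g ^+ i)%g x).
Proof.
move=> Tx gm im Ty; have /andP[i0 iltm] := im.
have := Tx i im; have := Ty (m - i)%N; rewrite subn_gt0 iltm ltn_subrL i0 /=.
rewrite (leq_trans i0 (ltnW iltm)) => /(_ isT).
rewrite -(act_mul pmp) -expgnDr subnK ?(ltnW iltm)// gm (act_one pmp).
by move=> /lt_trans h /h; rewrite ltxx.
Qed.

(** The [m] translates of the transversal cover the space and have equal measure. *)
Lemma cyclic_min_measure g m : (0 < m)%N -> (g ^+ m = 1)%g ->
  (forall i, (0 < i < m)%N -> (g ^+ i)%g != 1%g) ->
  ((m%:R^-1)%:E <= mu (cyclic_min g m))%E.
Proof.
move=> m0 gm gi.
pose F (i : 'I_m) := act (g ^+ i)%g @^-1` cyclic_min g m.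
have cover : [set x | exists i, F i x] = setT.
  apply/seteqP; split=> // x _.
  pose i0 := Ordinal m0.
  pose f (i : 'I_m) := code (act (g ^+ i)%g x).
  case: (@arg_minP _ _ _ i0 xpredT f isT) => i _ mini.
  exists i; rewrite /F /= => j /andP[j0 jm].
  rewrite lt_neqAle -(act_mul pmp) -expgnDr; apply/andP; split.
    apply/eqP => /code_inj /esym; rewrite expgnDr (act_mul pmp) => e.
    by have := gi j; rewrite j0 jm (fr e) eqxx => /(_ isT).
  have -> : (g ^+ (j + i) = g ^+ ((j + i) %% m))%g.
    by rewrite {1}(divn_eq (j + i) m) expgnDr mulnC expgnA gm expg1n mul1g.
  exact: (mini (Ordinal (ltn_pmod (j + i) m0))).
have mT := measurable_cyclic_min g m.
have fT : mu (cyclic_min g m) \is a fin_num by exact: fin_num_measure.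
have := @finite_union_bound _ F (fine (mu (cyclic_min g m))).
rewrite cover probability_setT card_ord -[mu _]fineK// !lee_fin => H.
rewrite -[leLHS]mul1r ler_pdivrMr ?ltr0n// mulrC; apply: H => i.
  by rewrite -[X in measurable X]setTI; apply: (act_measurable pmp).
by rewrite fineK// (act_preserves pmp).
Qed.

Lemma measurable_act_graph (t : G) :
  measurable [set p : X * X | p.1 = act t p.2].
Proof.
rewrite (_ : mkset _ =
    (fun p : X * X => code p.1 == code (act t p.2)) @^-1` [set true]).
  rewrite -[X in measurable X]setTI; apply: measurable_fun_eqr => //.
    exact: (measurableT_comp mcode measurable_fst).
  apply: (measurableT_comp mcode).
  exact: (measurableT_comp (act_measurable pmp t) measurable_snd).
by apply/seteqP; split=> p /=; [move=> ->; rewrite eqxx|move=> /eqP /code_inj].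
Qed.

Lemma measurable_act_graph_swap (t : G) :
  measurable [set p : X * X | p.2 = act t p.1].
Proof.
have := @measurable_swap _ _ X X measurableT _ (measurable_act_graph t).
by rewrite setTI.
Qed.

Lemma borel_pruned_schreier (S : set G) (s : G) (A : set X) :
  countable [set: G] -> measurable A ->
  borel_graph (schreier act S `\` edges_over act s A).
Proof.
move=> cG mA; split.
- apply: measurableD.
    rewrite (_ : schreier act S = ~` [set p : X * X | p.1 = act 1%g p.2] `&`
        [set p | exists t, S t /\ (p.1 = act t p.2 \/ p.2 = act t p.1)]).
      apply: measurableI; first by apply: measurableC; exact: measurable_act_graph.
      apply: countable_measurableU => // t; have [St|nSt] := pselect (S t).
        rewrite [X in measurable X](_ : _ = [set p : X * X | p.1 = act t p.2] `|`
            [set p : X * X | p.2 = act t p.1]).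
          apply: measurableU; first exact: measurable_act_graph.
          exact: measurable_act_graph_swap.
        by apply/seteqP; split=> p /=; [case|split].
      rewrite [X in measurable X](_ : _ = set0)//.
      by apply/seteqP; split=> // p [].
    apply/seteqP; split=> [[x y] [/= xy [z [t [St zt]]]]|[x y] /= [xy [t [St zt]]]].
      split; first by rewrite /= (act_one pmp).
      by exists t; split=> //=; case: zt => -[-> ->]; [left|right].
    split; first by rewrite (act_one pmp) in xy.
    by case: zt => ->; [exists y, t|exists x, t]; split=> //; [left|right].
  rewrite (_ : edges_over act s A =
      ([set p : X * X | p.1 = act s p.2] `&` snd @^-1` A) `|`
      ([set p : X * X | p.2 = act s p.1] `&` fst @^-1` A)).
    apply: measurableU; apply: measurableI.
    + exact: measurable_act_graph.
    + by rewrite -[X in measurable X]setTI; exact: measurable_snd.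
    + exact: measurable_act_graph_swap.
    + by rewrite -[X in measurable X]setTI; exact: measurable_fst.
  apply/seteqP; split=> [[x y] [z Az [[-> ->]|[-> ->]]]|[x y] /= [[-> Ay]|[-> Ax]]].
  + by left.
  + by right.
  + by exists y => //; left.
  + by exists x => //; right.
- move=> x y [[/= xy [z [t [St zt]]]] nA]; split.
    split; first by move=> /= /esym.
    by exists z, t; split=> //; case: zt => -[-> ->]; [right|left].
  move=> [z' Az' [] [z1 z2]]; apply: nA; exists z' => //; [right|left];
    by rewrite z1 z2.
- by move=> x [[]].
Qed.

End Bounds.

Section Assembly.
Variables (G : groupType) (P : set G) (L : nat) (Pi : nat -> set G)
  (phi : nat -> G -> int).
Hypothesis ps : positive_system P L Pi phi.

(** The kernels [K_i] of the positive system; the trivial group is put at all other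
    indices, in particular at 0. *)
Definition level_kernel (i : nat) : set G :=
  if (1 <= i <= L)%N then [set g | generated (Pi i) g /\ phi i g = 0]
  else [set 1%g].

Lemma level_kernel_subgroup i : is_subgroup (level_kernel i).
Proof.
rewrite /level_kernel; case: ifPn => [iL|_].
  exact: int_morph_ker (generated_subgroup _) (ps_morph ps iL).
by split=> // [x y -> ->|x ->]; rewrite ?mulg1 ?invg1.
Qed.

Lemma positive_system_bound : exists N : nat, forall i g, (1 <= i <= L)%N ->
  Pi i g -> phi i g <= N%:Z.
Proof.
have /finite_seqP[r Pr] := ps_finite ps.
exists (\max_(i < L.+1) \max_(g <- r) `|phi i g|)%N => i g iL Pg.
have gr : g \in r by have := positive_system_sub ps iL Pg; rewrite Pr.
have iL1 : (i < L.+1)%N by case/andP: iL.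
have le : (`|phi i g| <= \max_(i < L.+1) \max_(g <- r) `|phi i g|)%N.
  apply: (leq_trans _ (leq_bigmax (Ordinal iL1))) => /=.
  exact: (@leq_bigmax_seq _ _ _ (fun g => `|phi i g|%N)).
by rewrite (le_trans (ler_norm _))// -abszE lez_nat.
Qed.

Lemma positive_system_unit : exists h : nat -> G, forall i, (1 <= i <= L)%N ->
  generated (Pi i) (h i) /\ phi i (h i) = 1.
Proof.
have H i : exists g, (1 <= i <= L)%N -> generated (Pi i) g /\ phi i g = 1.
  have [iL|] := boolP (1 <= i <= L)%N; last by exists 1%g.
  by have [g Pg pg] := ps_surj ps iL 1; exists g.
by have [h hP] := choice H; exists h.
Qed.

End Assembly.

Theorem theorem3p4 (R : realType) (G : groupType) (S : set G) (w : seq G)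
    (m : nat) (s : G)
    (countableG : countable [set: G])
    (genS : generated S = [set: G])
    (wS : is_word S w)
    (m_gt0 : (1 <= m)%N)
    (embedded_wm : embedded_relation (word_pow w m))
    (Ss : S s)
    (s_wm : appears s (word_pow w m))
    (Q : set G)
    (defQ : Q = step_set (word_pow w m) s)
    (powQ : [set (word_val w ^+ i)%g | i in `I_m] `<=` Q)
    (P : set G)
    (defP : P = Q `\` [set (word_val w ^+ i)%g | i in `I_m])
    (posP : has_positive_system P) :
  exists (d : measure_display) (X : measurableType d) (mu : probability X R)
    (act : G -> X -> X),
    [/\ standard_borel R X, pmp_action mu act, free_action act
      & forall e : R, 0 < e ->
          exists A : set X,
            [/\ measurable A,
                ((m%:R^-1 - e)%:E <= mu A)%E
              & graphing mu act (schreier act S `\` edges_over act s A)]].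

Proof.
have [L [Pi [phi ps]]] := posP; subst P Q.
pose K := level_kernel L Pi phi.
have sK i : is_subgroup (K i) by exact: (level_kernel_subgroup ps).
have [rep [repK repE]] := exists_coset_rep sK.
have rep0 g : rep 0%N g = g by apply/esym/divg1_eq; exact: (repK 0%N g).
have repI i g : rep i (rep i g) = rep i g.
  by apply/repE; have [_ _ KV] := sK i; have := KV _ (repK i g); rewrite invgF.
have repM i g u : rep i (rep i g * u)%g = rep i (g * u)%g.
  apply/repE; rewrite mulgKA; have [_ _ KV] := sK i.
  by have := KV _ (repK i g); rewrite invgF.
have [d [X [mu [act [code [lab la]]]]]] :=
  exists_labelled_action R countableG rep0 repI repM.
exists d, X, mu, act.
have [borelX pmp fr mcode icode mlab labE labK markM recur] := la.
split=> // e e0.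
have [N NP] := positive_system_bound ps.
have [h hP] := positive_system_unit ps.
pose mark k i x u := forall b, (b < k)%N -> lab x u i b.
(* L * N cosets must be unmarked, each being marked with probability 2 ^ - k. *)
have [k kP] := @exists_small_dyadic R (L * N)%:R e (ler0n _ _) e0.
pose F (p : 'I_L * 'I_N) : set X := [set x | mark k p.1.+1 x (h p.1.+1 ^+ p.2)%g].
pose T := cyclic_min act code (word_val w) m.
pose A := T `&` ~` [set x | exists p, F p x].
(* A conull invariant set on which labels are constant on cosets and every sequence
   of marks has one to the right of the origin. *)
pose X0 : set X := [set x |
  (forall i u v b, rep i u = rep i v -> lab x u i b = lab x v i b) /\
  (forall i u, (1 <= i <= L)%N -> exists l, mark k i x (h i ^+ l * u)%g)].
have w_gt0 : (0 < size w)%N.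
  rewrite lt0n; apply/eqP => /size0nil w0; move: s_wm; rewrite w0 /appears.
  by have -> : word_pow [::] m = [::] :> seq G by elim: (m).
have wm := embedded_word_valX embedded_wm.
have wi i := @embedded_word_val_neq1 _ _ _ embedded_wm w_gt0 i.
have kerK i v : (1 <= i <= L)%N -> K i v = (generated (Pi i) v /\ phi i v = 0).
  by move=> iL; rewrite /K /level_kernel iL.
have X0_act g x : X0 x -> X0 (act g x).
  move=> [xK xr]; split=> [i u v b uv|i u iL].
    rewrite !labE; apply: xK.
    by rewrite -[LHS]repM uv repM.
  by have [l H] := xr i (u * g)%g iL; exists l => b bk; rewrite labE -mulgA; exact: H.
have mmark i u : measurable [set x | mark k i x u].
  exact: (@measurable_all_lt _ X (fun b x => lab x u i b)).
have aeX0 : {ae mu, forall x, X0 x}.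
  have ae1 : {ae mu, forall x, forall j : G * G * nat * nat,
      rep j.2 j.1.1.1 = rep j.2 j.1.1.2 ->
      lab x j.1.1.1 j.2 j.1.2 = lab x j.1.1.2 j.2 j.1.2}.
    apply: countable_ae => [|[[[u v] b] i]].
      by do 3!apply: countable_setT_prod => //.
    have [uv|nuv] := pselect (rep i u = rep i v); last by apply: aeW.
    by apply: filterS (labK u v i b uv) => x.
  have ae2 : {ae mu, forall x, forall j : G * nat, (1 <= j.2 <= L)%N ->
      exists l, mark k j.2 x (h j.2 ^+ l * j.1)%g}.
    apply: countable_ae => [|[u i] /=].
      exact: countable_setT_prod.
    have [iL|niL] := boolP (1 <= i <= L)%N; last by apply: aeW.
    have [Hh ph] := hP _ iL.
    have := @recur i k (fun l => h i ^+ l * u)%g.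
    have inj : injective (rep i \o (fun l => h i ^+ l * u)%g).
      move=> l l' /= /repE; rewrite kerK// mulgKA => -[_].
      have sH := generated_subgroup (Pi i); have [_ _ HV] := sH.
      have HX q : generated (Pi i) (h i ^+ q)%g by exact: (subgroupX q sH Hh).
      rewrite (ps_morph ps iL (HX l) (HV _ (HX l'))).
      rewrite (int_morphV sH (ps_morph ps iL))// !(int_morphX sH (ps_morph ps iL))// ph.
      by lia.
    by move=> /(_ inj); apply: filterS => x [l H] _; exists l.
  apply: (filterS _ (filterI ae1 ae2)) => x [H1 H2]; split=> [i u v b uv|i u iL].
    exact: (H1 (u, v, b, i)).
  exact: (H2 (u, i)).
have mT : measurable T by exact: (measurable_cyclic_min pmp mcode).
have mF p : measurable (F p) by exact: mmark.
have mA : measurable A.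
  apply: measurableI => //; apply: measurableC.
  exact: countable_measurableU.
exists A; split=> //.
  have := cyclic_min_measure pmp fr mcode icode m_gt0 wm wi; rewrite -/T => muT.
  have muF : (mu [set x | exists p, F p x] <= e%:E)%E.
    apply: (@le_trans _ _ ((L * N)%:R * 2^-1 ^+ k)%:E); last by rewrite lee_fin.
    have := @finite_union_bound _ _ _ mu _ F (2^-1 ^+ k) mF.
    rewrite card_prod !card_ord; apply => p.
    by rewrite le_eqVlt /F /mark markM eqxx.
  rewrite EFinB leeBlDr//; apply: (le_trans muT).
  apply: (@le_trans _ _ (mu (A `|` [set x | exists p, F p x]))).
    apply: le_measure; rewrite ?inE//.
      by apply: measurableU => //; exact: countable_measurableU.
    by move=> x Tx; have [Fx|nFx] := pselect (exists p, F p x); [right|left].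
  rewrite (le_trans (measureU2 _ _ _))//; first exact: countable_measurableU.
  exact: leeD.
split; first exact: (borel_pruned_schreier pmp mcode icode).
apply: filterS aeX0 => x x0.
have pow1 : [set (word_val w ^+ i)%g | i in `I_m] 1%g by exists 0%N.
apply: (component_orbit (act_one pmp) (act_mul pmp) fr wS m_gt0
  embedded_wm genS X0_act powQ _ _ _ x0).
- by move=> y i [Ty _] im [Ty' _]; exact: (cyclic_min_separated pmp Ty wm im Ty').
- apply: (positive_system_descent X0_act (h := h) (N := N) (mark := mark k) ps hP NP).
  + by move=> i g y u; split=> H b bk; have := H b bk; rewrite labE.
  + move=> i y q u iL [yK _] Hq pq My b bk; rewrite -(yK i u _ b); first exact: My.
    by apply/esym/repE; rewrite kerK// mulgK.
  + by move=> i y iL [_ yr]; have [l H] := yr i 1%g iL; exists l; rewrite mulg1 in H.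
  + move=> i y l /andP[i1 iL] [_ nF] lN My; apply: nF.
    have i1L : (i.-1 < L)%N by rewrite prednK.
    by exists (Ordinal i1L, Ordinal lN); rewrite /F /= prednK.
- exact: cycle_length_neq2 embedded_wm pow1 powQ ps.
Qed.
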